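(* Let the standing assumptions and the AGILS algorithm be as described in the context, with $\epsilon>0$, $\gamma\in(0,1/(\rho_{f_2}+\rho_{g_2}))$, and step sizes satisfying, for all $k$, $\alpha_k\in[\underline{\alpha},\,2/(L_{\psi_{x,k}}+c_\alpha)]$ and $\beta_k\in[\underline{\beta},\,2/(L_{\psi_{y,k}}+c_\beta)]$, where $L_{\psi_{x,k}}=L_{F_x}/p_k+L_{f_x}+L_{g_1}+\rho_{f_1}+\rho_{g_1}$, $L_{\psi_{y,k}}=L_{F_y}/p_k+L_{f_y}$, and $\underline{\alpha},\underline{\beta},c_\alpha,c_\beta$ are positive constants. Let $\{(x^k,y^k,\tilde y^k)\}$ and $\{p_k\}$ be generated by AGILS. If the sequence $\{p_k\}$ is bounded, then any accumulation point $(\bar x,\bar y)$ of $\{(x^k,y^k)\}$ is a KKT point of $({\rm VP})_\gamma^{\bar\epsilon}$ for some $\bar\epsilon\le\epsilon$.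
   Context: **Problem and standing assumptions.** $X\subset\mathbb{R}^n$, $Y\subset\mathbb{R}^m$ are closed convex sets; $F,f,g:\mathbb{R}^n\times\mathbb{R}^m\to\mathbb{R}$; $\varphi:=f+g$. A function $h$ is $(\rho_1,\rho_2)$-weakly convex on $X\times Y$ (with $\rho_1,\rho_2\ge 0$) if $h(x,y)+\frac{\rho_1}{2}\|x\|^2+\frac{\rho_2}{2}\|y\|^2$ is convex on $X\times Y$. Assume: - $\underline F:=\inf_{X\times Y}F>-\infty$; $F$ is continuously differentiable and $\nabla_xF$, $\nabla_yF$ are $L_{F_x}$-, $L_{F_y}$-Lipschitz continuous on $X\times Y$. - For every $x\in X$, $f(x,\cdot)$ and $g(x,\cdot)$ are convex on $Y$. - $f$ is continuously differentiable on $X\times Y$ and $\nabla_xf$, $\nabla_yf$ are $L_{f_x}$-, $L_{f_y}$-Lipschitz on $X\times Y$. - $g$ is continuous on $X\times Y$, $\nabla_xg(x,y)$ exists there, $\nabla_xg(\cdot,y)$ is $L_{g_1}$-Lipschitz on $X$ for every $y\in Y$, and $\nabla_xg(x,\cdot)$ is $L_{g_2}$-Lipschitz on $Y$ for every $x\in X$. - $f$ is $(\rho_{f_1},\rho_{f_2})$-weakly convex and $g$ is $(\rho_{g_1},\rho_{g_2})$-weakly convex on $X\times Y$. For $\gamma>0$ let $v_\gamma(x,y):=\inf_{\theta\in Y}\{\varphi(x,\theta)+\frac{1}{2\gamma}\|\theta-y\|^2\}$, with unique minimizer $\theta^*_\gamma(x,y)$. For $\gamma\in(0,1/(\rho_{f_2}+\rho_{g_2}))$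 (with $1/0=+\infty$), $v_\gamma$ is differentiable on $X\times\mathbb{R}^m$ with $\nabla v_\gamma(x,y)=\big(\nabla_xf(x,\theta^*_\gamma(x,y))+\nabla_xg(x,\theta^*_\gamma(x,y)),\,(y-\theta^*_\gamma(x,y))/\gamma\big)$. **Problem $({\rm VP})_\gamma^{\epsilon}$:** minimize $F(x,y)$ over $x\in X$, $y\in Y$ subject to $\varphi(x,y)-v_\gamma(x,y)\le\epsilon$. **KKT point.** A point $(\bar x,\bar y)\in X\times Y$ is a KKT (stationary) point of $({\rm VP})_\gamma^{\bar\epsilon}$ if $\varphi(\bar x,\bar y)-v_\gamma(\bar x,\bar y)\le\bar\epsilon$ and there is $\lambda\ge0$ with $0\in\nabla F(\bar x,\bar y)+\lambda(\nabla f(\bar x,\bar y)+\partial g(\bar x,\bar y)-\nabla v_\gamma(\bar x,\bar y))+\mathcal{N}_{X\times Y}(\bar x,\bar y)$ and $\lambda(\varphi(\bar x,\bar y)-v_\gamma(\bar x,\bar y)-\bar\epsilon)=0$. Here $\partial$ is the limiting (Mordukhovich) subdifferential and $\mathcal{N}$ the normal cone. **Algorithm AGILS.** Notation: $\tilde g(x,y):=g(x,y)+\delta_Y(y)$ ($\delta_Y$ the indicator function), $\operatorname{Prox}_h(y):=\arg\min_\theta\{h(\theta)+\frac12\|\theta-y\|^2\}$, and for fixed $\eta>0$, $$\mathcal{G}(\theta,x,y):=\big\|\theta-\operatorname{Prox}_{\eta\tilde g(x,\cdot)}\big(\theta-\eta(\nabla_yf(x,\theta)+(\theta-y)/\gamma)\big)\big\|.$$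 Parameters: $\epsilon>0$, $\gamma>0$, step sizes $\alpha_k,\beta_k>0$, $p_0>0$, $\varrho_p>0$, $c_p>0$, $c_y>0$, $c_{\tilde y}>0$, $s_k\ge0$ with $\sum_k s_k^2<\infty$, $\tau_k:=\tau_0/(k+1)^{p_\tau}$ with $\tau_0>0$, $p_\tau>0$. Initial points $x^0\in X$, $y^0,\tilde y^0,\tilde\theta^0\in Y$; $\theta^0:=\tilde\theta^0$, $(x^{-1},y^{-1},\theta^{-1}):=(x^0,y^0,\tilde\theta^0)$. For $k=0,1,2,\dots$ (infinitely many iterations): 1. $d_y^k:=\frac1{p_k}\nabla_yF(x^k,\tilde y^k)+\nabla_yf(x^k,\tilde y^k)-(\tilde y^k-\tilde\theta^k)/\gamma$ and $y^{k+1}:=\operatorname{Prox}_{\beta_k\tilde g(x^k,\cdot)}(\tilde y^k-\beta_kd_y^k)$. 2. Find $\theta^{k+1/2}\in Y$ with $\mathcal{G}(\theta^{k+1/2},x^k,y^{k+1})\le\max\{s_k,\tau_k\mathcal{G}(\theta^{k-1},x^{k-1},y^{k-1})\}$. 3. $d_x^k:=\frac1{p_k}\nabla_xF(x^k,y^{k+1})+\nabla_x\varphi(x^k,y^{k+1})-\nabla_xf(x^k,\theta^{k+1/2})-\nabla_xg(x^k,\theta^{k+1/2})$ and $x^{k+1}:=\operatorname{Proj}_X(x^k-\alpha_kd_x^k)$. 4. Find $\theta^{k+1}\in Y$ with $\mathcal{G}(\theta^{k+1},x^{k+1},y^{k+1})\le\max\{s_{k+1},\tau_{k+1}\mathcal{G}(\theta^k,x^k,y^k)\}$.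 5. $\Delta_{k+1}:=\|(x^{k+1},y^{k+1})-(x^k,\tilde y^k)\|$, $t^{k+1}:=\max\{\varphi(x^{k+1},y^{k+1})-\varphi(x^{k+1},\theta^{k+1})-\frac1{2\gamma}\|\theta^{k+1}-y^{k+1}\|^2-\epsilon,\,0\}$. 6. Case 1: if $\Delta_{k+1}\ge c_p\min\{1/p_k,t^{k+1}\}$, set $p_{k+1}:=p_k$, $\tilde y^{k+1}:=y^{k+1}$, $\tilde\theta^{k+1}:=\theta^{k+1}$. Case 2: if $\Delta_{k+1}<c_p\min\{1/p_k,t^{k+1}\}$ and $\|y^{k+1}-\theta^{k+1}\|\le c_y\gamma/p_k$, set $p_{k+1}:=p_k+\varrho_p$, $\tilde y^{k+1}:=y^{k+1}$, $\tilde\theta^{k+1}:=\theta^{k+1}$. Case 3: if $\Delta_{k+1}<c_p\min\{1/p_k,t^{k+1}\}$ and $\|y^{k+1}-\theta^{k+1}\|>c_y\gamma/p_k$, apply the feasibility correction procedure. **Feasibility correction procedure** (at iteration $k$): find a candidate $\tilde y^{k+1}\in Y$ with $\|\tilde y^{k+1}-\operatorname{Prox}_{\tilde g(x^{k+1},\cdot)}(\tilde y^{k+1}-\nabla_yf(x^{k+1},\tilde y^{k+1}))\|\le\frac{c_{\tilde y}}{p_k}\Delta_{k+1}$; find $\hat\theta^{k+1}\in Y$ with $\mathcal{G}(\hat\theta^{k+1},x^{k+1},\tilde y^{k+1})\le\max\{s_{k+1},\tau_{k+1}\mathcal{G}(\theta^k,x^k,y^k)\}$; set $\tilde\theta^{k+1}:=\operatorname{Prox}_{\eta\tilde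 g(x^{k+1},\cdot)}\big(\hat\theta^{k+1}-\eta(\nabla_yf(x^{k+1},\hat\theta^{k+1})+(\hat\theta^{k+1}-\tilde y^{k+1})/\gamma)\big)$. If $$\tfrac1{p_k}F(x^{k+1},\tilde y^{k+1})+\varphi(x^{k+1},\tilde y^{k+1})-\varphi(x^{k+1},\tilde\theta^{k+1})-\tfrac1{2\gamma}\|\tilde\theta^{k+1}-\tilde y^{k+1}\|^2\le\tfrac1{p_k}F(x^{k+1},y^{k+1})+\varphi(x^{k+1},y^{k+1})-\varphi(x^{k+1},\theta^{k+1})-\tfrac1{2\gamma}\|\theta^{k+1}-y^{k+1}\|^2,$$ accept the candidate pair $(\tilde y^{k+1},\tilde\theta^{k+1})$ and set $p_{k+1}:=p_k$; otherwise reset $\tilde y^{k+1}:=y^{k+1}$, $\tilde\theta^{k+1}:=\theta^{k+1}$ and set $p_{k+1}:=p_k+\varrho_p$.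
   Formalization: In the KKT condition, ∂g is read as the limiting subdifferential of g plus the indicator of X×Y (g = +∞ outside X×Y), since with arbitrary values of g off X×Y the claim fails, e.g. Y={0}×R, F=f=0, g=-√|y₁|. *)

(* Defs.v *)
From HB Require Import structures.
From mathcomp Require Import all_boot all_order all_algebra.
From mathcomp Require Import all_classical all_reals all_analysis.
Import Order.TTheory GRing.Theory Num.Theory.
Import numFieldNormedType.Exports.

Set Implicit Arguments.
Unset Strict Implicit.
Unset Printing Implicit Defensive.

Local Open Scope classical_set_scope.
Local Open Scope ring_scope.

(* Euclidean structure on 'rV_n and on 'rV_n * 'rV_m.  The library norm `|u|
   is the sup norm: it induces the right topology and the right notion of
   differentiability, but every quantitative estimate below is Euclidean. *)
Definition dot (R : realType) (n : nat) (u v : 'rV[R]_n) : R :=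
  \sum_(i < n) u 0 i * v 0 i.

Definition enorm (R : realType) (n : nat) (u : 'rV[R]_n) : R :=
  Num.sqrt (dot u u).

Definition pdot (R : realType) (n m : nat) (z w : 'rV[R]_n * 'rV[R]_m) : R :=
  dot z.1 w.1 + dot z.2 w.2.

Definition pnorm (R : realType) (n m : nat) (z : 'rV[R]_n * 'rV[R]_m) : R :=
  Num.sqrt (pdot z z).

Definition grad (R : realType) (n : nat) (h : 'rV[R]_n -> R) (x : 'rV[R]_n) :
    'rV[R]_n :=
  \row_(i < n) 'D_(delta_mx 0 i) h x.

Definition gradx (R : realType) (n m : nat) (h : 'rV[R]_n * 'rV[R]_m -> R)
    (z : 'rV[R]_n * 'rV[R]_m) : 'rV[R]_n :=
  grad (fun x => h (x, z.2)) z.1.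

Definition grady (R : realType) (n m : nat) (h : 'rV[R]_n * 'rV[R]_m -> R)
    (z : 'rV[R]_n * 'rV[R]_m) : 'rV[R]_m :=
  grad (fun y => h (z.1, y)) z.2.

Definition pgrad (R : realType) (n m : nat) (h : 'rV[R]_n * 'rV[R]_m -> R)
    (z : 'rV[R]_n * 'rV[R]_m) : 'rV[R]_n * 'rV[R]_m :=
  (gradx h z, grady h z).

Definition C1_on (R : realType) (n m : nat) (D : set ('rV[R]_n * 'rV[R]_m))
    (h : 'rV[R]_n * 'rV[R]_m -> R) : Prop :=
  (forall z, D z -> differentiable h z) /\ {within D, continuous (pgrad h)}.

Definition lipschitz_onE (R : realType) (n m q : nat)
    (D : set ('rV[R]_n * 'rV[R]_m)) (L : R)
    (G : 'rV[R]_n * 'rV[R]_m -> 'rV[R]_q) : Prop :=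
  forall z w, D z -> D w -> enorm (G z - G w) <= L * pnorm (z - w).

Definition weakly_convex (R : realType) (n m : nat) (rho1 rho2 : R)
    (D : set ('rV[R]_n * 'rV[R]_m)) (h : 'rV[R]_n * 'rV[R]_m -> R) : Prop :=
  convex_function D
    (fun z => h z + rho1 / 2 * enorm z.1 ^+ 2 + rho2 / 2 * enorm z.2 ^+ 2).

Definition indicator_fun (R : realType) (T : Type) (C : set T) (t : T) :
    \bar R :=
  if t \in C then 0%E else +oo%E.

Definition normal_cone (R : realType) (n m : nat)
    (C : set ('rV[R]_n * 'rV[R]_m)) (z : 'rV[R]_n * 'rV[R]_m) :
    set ('rV[R]_n * 'rV[R]_m) :=
  [set w | forall u, C u -> pdot w (u - z) <= 0].

(* w is a regular (Frechet) subgradient of h at z: h(z) is finite and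
   h(z') >= h(z) + <w, z' - z> - o(|z' - z|) as z' -> z. *)
Definition frechet_subdiff (R : realType) (n m : nat)
    (h : 'rV[R]_n * 'rV[R]_m -> \bar R) (z : 'rV[R]_n * 'rV[R]_m) :
    set ('rV[R]_n * 'rV[R]_m) :=
  [set w | h z \is a fin_num /\
    forall e : R, 0 < e -> \forall z' \near z,
      (h z + (pdot w (z' - z) - e * pnorm (z' - z))%:E <= h z')%E].

Definition limiting_subdiff (R : realType) (n m : nat)
    (h : 'rV[R]_n * 'rV[R]_m -> \bar R) (z : 'rV[R]_n * 'rV[R]_m) :
    set ('rV[R]_n * 'rV[R]_m) :=
  [set w | h z \is a fin_num /\
    exists zs ws : nat -> 'rV[R]_n * 'rV[R]_m,
      [/\ zs k @[k --> \oo] --> z,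
          h (zs k) @[k --> \oo] --> h z,
          forall k, frechet_subdiff h (zs k) (ws k) &
          ws k @[k --> \oo] --> w]].

(* [get A] is an element of A when A is nonempty; the argmin sets below are
   singletons in all uses made of [Prox], [Proj] and [thetastar]. *)
Definition Prox (R : realType) (m : nat) (h : 'rV[R]_m -> \bar R)
    (y : 'rV[R]_m) : 'rV[R]_m :=
  get [set th | forall u,
    (h th + (2^-1 * enorm (th - y) ^+ 2)%:E <=
     h u + (2^-1 * enorm (u - y) ^+ 2)%:E)%E].

Definition Proj (R : realType) (n : nat) (X : set 'rV[R]_n) (z : 'rV[R]_n) :
    'rV[R]_n :=
  get [set u | X u /\ forall v, X v -> enorm (u - z) <= enorm (v - z)].

Record bilevel (R : realType) (n m : nat) := Bilevel {
  bX : set 'rV[R]_n;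
  bY : set 'rV[R]_m;
  bF : 'rV[R]_n * 'rV[R]_m -> R;
  bf : 'rV[R]_n * 'rV[R]_m -> R;
  bg : 'rV[R]_n * 'rV[R]_m -> R
}.

Definition bXY (R : realType) (n m : nat) (P : bilevel R n m) :
    set ('rV[R]_n * 'rV[R]_m) :=
  bX P `*` bY P.

Definition bphi (R : realType) (n m : nat) (P : bilevel R n m)
    (z : 'rV[R]_n * 'rV[R]_m) : R :=
  bf P z + bg P z.

Record constants (R : realType) := Constants {
  LFx : R; LFy : R;
  Lfx : R; Lfy : R;
  Lg1 : R; Lg2 : R;
  rhof1 : R; rhof2 : R;
  rhog1 : R; rhog2 : R
}.

Record standing (R : realType) (n m : nat) (P : bilevel R n m)
    (c : constants R) : Prop := Standing {
  X_closed : closed (bX P);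
  X_convex : convex_set (bX P);
  Y_closed : closed (bY P);
  Y_convex : convex_set (bY P);
  constants_ge0 : [/\ 0 <= LFx c, 0 <= LFy c, 0 <= Lfx c & 0 <= Lfy c] /\
                  0 <= Lg1 c /\ 0 <= Lg2 c;
  rho_ge0 : [/\ 0 <= rhof1 c, 0 <= rhof2 c, 0 <= rhog1 c & 0 <= rhog2 c];
  F_bounded_below : has_lbound (bF P @` bXY P);
  F_C1 : C1_on (bXY P) (bF P);
  gradxF_lipschitz : lipschitz_onE (bXY P) (LFx c) (gradx (bF P));
  gradyF_lipschitz : lipschitz_onE (bXY P) (LFy c) (grady (bF P));
  f_convex_y : forall x, bX P x -> convex_function (bY P) (fun y => bf P (x, y));
  g_convex_y : forall x, bX P x -> convex_function (bY P) (fun y => bg P (x, y));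
  f_C1 : C1_on (bXY P) (bf P);
  gradxf_lipschitz : lipschitz_onE (bXY P) (Lfx c) (gradx (bf P));
  gradyf_lipschitz : lipschitz_onE (bXY P) (Lfy c) (grady (bf P));
  g_continuous : {within bXY P, continuous (bg P)};
  g_differentiable_x : forall x y, bX P x -> bY P y ->
    differentiable (fun x' => bg P (x', y)) x;
  gradxg_lipschitz_x : forall y x x', bY P y -> bX P x -> bX P x' ->
    enorm (gradx (bg P) (x, y) - gradx (bg P) (x', y)) <=
      Lg1 c * enorm (x - x');
  gradxg_lipschitz_y : forall x y y', bX P x -> bY P y -> bY P y' ->
    enorm (gradx (bg P) (x, y) - gradx (bg P) (x, y')) <=
      Lg2 c * enorm (y - y');
  f_weakly_convex : weakly_convex (rhof1 c) (rhof2 c) (bXY P) (bf P);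
  g_weakly_convex : weakly_convex (rhog1 c) (rhog2 c) (bXY P) (bg P)
}.

(* A real infimum: for x in X the objective is bounded below on Y, since
   phi(x, .) is convex there. *)
Definition vgamma (R : realType) (n m : nat) (P : bilevel R n m) (gam : R)
    (z : 'rV[R]_n * 'rV[R]_m) : R :=
  inf [set bphi P (z.1, th) + (2 * gam)^-1 * enorm (th - z.2) ^+ 2
      | th in bY P].

Definition thetastar (R : realType) (n m : nat) (P : bilevel R n m) (gam : R)
    (z : 'rV[R]_n * 'rV[R]_m) : 'rV[R]_m :=
  get [set th | bY P th /\ forall th', bY P th' ->
    bphi P (z.1, th) + (2 * gam)^-1 * enorm (th - z.2) ^+ 2 <=
    bphi P (z.1, th') + (2 * gam)^-1 * enorm (th' - z.2) ^+ 2].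

(* The gradient of v_gamma on X * R^m, through its closed formula.
   The ambient derivative of [vgamma] would not do at boundary points
   of X, because nothing is assumed about f and g outside X * Y. *)
Definition grad_vgamma (R : realType) (n m : nat) (P : bilevel R n m) (gam : R)
    (z : 'rV[R]_n * 'rV[R]_m) : 'rV[R]_n * 'rV[R]_m :=
  let th := thetastar P gam z in
  (gradx (bf P) (z.1, th) + gradx (bg P) (z.1, th), gam^-1 *: (z.2 - th)).

(* The limiting subdifferential of g, where g is regarded, as usual, as equal
   to +oo outside the set X * Y on which assumptions are made about it.
   Without this convention the subdifferential at a boundary point of X * Y
   would depend on unconstrained values of g, and could be empty.  If g is
   weakly convex around X * Y, it equals the limiting subdifferential of g
   itself plus the normal cone of X * Y, so that stationarity is unaffected. *)
Definition subdiff_g (R : realType) (n m : nat) (P : bilevel R n m)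
    (z : 'rV[R]_n * 'rV[R]_m) : set ('rV[R]_n * 'rV[R]_m) :=
  limiting_subdiff (fun w => ((bg P w)%:E + indicator_fun R (bXY P) w)%E) z.

(* KKT points of: minimize F over X * Y subject to phi - v_gamma <= eps. *)
Definition is_KKT (R : realType) (n m : nat) (P : bilevel R n m) (gam eps : R)
    (z : 'rV[R]_n * 'rV[R]_m) : Prop :=
  [/\ bXY P z,
      bphi P z - vgamma P gam z <= eps &
      exists lam : R,
        [/\ 0 <= lam,
            exists xi nu, [/\ subdiff_g P z xi, normal_cone (bXY P) z nu &
              0 = pgrad (bF P) z
                  + lam *: (pgrad (bf P) z + xi - grad_vgamma P gam z) + nu] &
            lam * (bphi P z - vgamma P gam z - eps) = 0]].

(* The function g~(x, .) = g(x, .) + delta_Y. *)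
Definition gtilde (R : realType) (n m : nat) (P : bilevel R n m)
    (x : 'rV[R]_n) (y : 'rV[R]_m) : \bar R :=
  ((bg P (x, y))%:E + indicator_fun R (bY P) y)%E.

Record agils_param (R : realType) := AgilsParam {
  a_eps : R; a_gam : R; a_eta : R;
  a_alpha : nat -> R; a_beta : nat -> R;
  a_p0 : R; a_rho : R;
  a_cp : R; a_cy : R; a_cyt : R;
  a_s : nat -> R; a_tau0 : R; a_ptau : R
}.

Definition agils_param_ok (R : realType) (a : agils_param R) : Prop :=
  [/\ 0 < a_eps a, 0 < a_gam a & 0 < a_eta a] /\
  (forall k, 0 < a_alpha a k /\ 0 < a_beta a k) /\
  [/\ 0 < a_p0 a, 0 < a_rho a, 0 < a_cp a, 0 < a_cy a & 0 < a_cyt a] /\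
  (forall k, 0 <= a_s a k) /\ cvgn (series (fun k => a_s a k ^+ 2)) /\
  0 < a_tau0 a /\ 0 < a_ptau a.

Definition a_tau (R : realType) (a : agils_param R) (k : nat) : R :=
  a_tau0 a / (k.+1%:R `^ a_ptau a).

(* [s_thh q k] is theta^(k + 1/2); [s_yt], [s_tht] are y~ and theta~. *)
Record agils_seq (R : realType) (n m : nat) := AgilsSeq {
  s_x : nat -> 'rV[R]_n;
  s_y : nat -> 'rV[R]_m;
  s_yt : nat -> 'rV[R]_m;
  s_th : nat -> 'rV[R]_m;
  s_thh : nat -> 'rV[R]_m;
  s_tht : nat -> 'rV[R]_m;
  s_p : nat -> R
}.

Definition prox_step (R : realType) (n m : nat) (P : bilevel R n m)
    (a : agils_param R) (th : 'rV[R]_m) (x : 'rV[R]_n) (y : 'rV[R]_m) :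
    'rV[R]_m :=
  Prox (fun u => ((a_eta a)%:E * gtilde P x u)%E)
    (th - a_eta a *: (grady (bf P) (x, th) + (a_gam a)^-1 *: (th - y))).

Definition residual (R : realType) (n m : nat) (P : bilevel R n m)
    (a : agils_param R) (th : 'rV[R]_m) (x : 'rV[R]_n) (y : 'rV[R]_m) : R :=
  enorm (th - prox_step P a th x y).

Definition gap (R : realType) (n m : nat) (P : bilevel R n m)
    (a : agils_param R) (x : 'rV[R]_n) (y th : 'rV[R]_m) : R :=
  bphi P (x, y) - bphi P (x, th) - (2 * a_gam a)^-1 * enorm (th - y) ^+ 2.

Definition dy (R : realType) (n m : nat) (P : bilevel R n m)
    (a : agils_param R) (q : agils_seq R n m) (k : nat) : 'rV[R]_m :=
  (s_p q k)^-1 *: grady (bF P) (s_x q k, s_yt q k)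
  + grady (bf P) (s_x q k, s_yt q k)
  - (a_gam a)^-1 *: (s_yt q k - s_tht q k).

Definition dx (R : realType) (n m : nat) (P : bilevel R n m)
    (q : agils_seq R n m) (k : nat) : 'rV[R]_n :=
  (s_p q k)^-1 *: gradx (bF P) (s_x q k, s_y q k.+1)
  + gradx (bphi P) (s_x q k, s_y q k.+1)
  - gradx (bf P) (s_x q k, s_thh q k)
  - gradx (bg P) (s_x q k, s_thh q k).

(* [Delta q k] is Delta_(k + 1), and [tres P a q k] is t^(k + 1). *)
Definition Delta (R : realType) (n m : nat) (q : agils_seq R n m) (k : nat) :
    R :=
  pnorm ((s_x q k.+1, s_y q k.+1) - (s_x q k, s_yt q k)).

Definition tres (R : realType) (n m : nat) (P : bilevel R n m)
    (a : agils_param R) (q : agils_seq R n m) (k : nat) : R :=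
  Num.max (gap P a (s_x q k.+1) (s_y q k.+1) (s_th q k.+1) - a_eps a) 0.

Definition plain_update (R : realType) (n m : nat) (q : agils_seq R n m)
    (k : nat) (p' : R) : Prop :=
  [/\ s_p q k.+1 = p', s_yt q k.+1 = s_y q k.+1 & s_tht q k.+1 = s_th q k.+1].

Definition feasibility_correction (R : realType) (n m : nat)
    (P : bilevel R n m) (a : agils_param R) (q : agils_seq R n m) (k : nat) :
    Prop :=
  let x1 := s_x q k.+1 in
  let y1 := s_y q k.+1 in
  exists yc thhat : 'rV[R]_m,
    let thc := prox_step P a thhat x1 yc in
    [/\ bY P yc,
        enorm (yc - Prox (gtilde P x1) (yc - grady (bf P) (x1, yc)))
          <= a_cyt a / s_p q k * Delta q k,
        bY P thhat,
        residual P a thhat x1 yc <=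
          Num.max (a_s a k.+1)
            (a_tau a k.+1 * residual P a (s_th q k) (s_x q k) (s_y q k)) &
        if (s_p q k)^-1 * bF P (x1, yc) + gap P a x1 yc thc <=
           (s_p q k)^-1 * bF P (x1, y1) + gap P a x1 y1 (s_th q k.+1)
        then [/\ s_yt q k.+1 = yc, s_tht q k.+1 = thc & s_p q k.+1 = s_p q k]
        else plain_update q k (s_p q k + a_rho a)].

(* The index -1 of the algorithm carries the same data (x^0, y^0, theta^0) as
   the index 0, so that k - 1 is rendered by k.-1, including for k = 0. *)
Definition agils_step (R : realType) (n m : nat) (P : bilevel R n m)
    (a : agils_param R) (q : agils_seq R n m) (k : nat) : Prop :=
  let threshold := a_cp a * Num.min (s_p q k)^-1 (tres P a q k) in
  let dist := enorm (s_y q k.+1 - s_th q k.+1) in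
  [/\ s_y q k.+1 =
        Prox (fun u => ((a_beta a k)%:E * gtilde P (s_x q k) u)%E)
          (s_yt q k - a_beta a k *: dy P a q k),
      bY P (s_thh q k) /\
      residual P a (s_thh q k) (s_x q k) (s_y q k.+1) <=
        Num.max (a_s a k)
          (a_tau a k * residual P a (s_th q k.-1) (s_x q k.-1) (s_y q k.-1)),
      s_x q k.+1 = Proj (bX P) (s_x q k - a_alpha a k *: dx P q k),
      bY P (s_th q k.+1) /\
      residual P a (s_th q k.+1) (s_x q k.+1) (s_y q k.+1) <=
        Num.max (a_s a k.+1)
          (a_tau a k.+1 * residual P a (s_th q k) (s_x q k) (s_y q k)) &
      [/\ threshold <= Delta q k -> plain_update q k (s_p q k),
          Delta q k < threshold -> dist <= a_cy a * a_gam a / s_p q k ->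
            plain_update q k (s_p q k + a_rho a) &
          Delta q k < threshold -> a_cy a * a_gam a / s_p q k < dist ->
            feasibility_correction P a q k]].

Definition agils_init (R : realType) (n m : nat) (P : bilevel R n m)
    (a : agils_param R) (q : agils_seq R n m) : Prop :=
  [/\ bX P (s_x q 0%N), bY P (s_y q 0%N), bY P (s_yt q 0%N) &
      bY P (s_tht q 0%N)] /\
  s_th q 0%N = s_tht q 0%N /\ s_p q 0%N = a_p0 a.

Definition agils (R : realType) (n m : nat) (P : bilevel R n m)
    (a : agils_param R) (q : agils_seq R n m) : Prop :=
  agils_init P a q /\ forall k, agils_step P a q k.

Definition Lpsix (R : realType) (c : constants R) (p : R) : R :=
  LFx c / p + Lfx c + Lg1 c + rhof1 c + rhog1 c.

Definition Lpsiy (R : realType) (c : constants R) (p : R) : R :=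
  LFy c / p + Lfy c.

(* Main.v *)
Require Import Defs.
From HB Require Import structures.
From mathcomp Require Import all_boot all_order all_algebra.
From mathcomp Require Import all_classical all_reals all_analysis.
From mathcomp Require Import ring lra.
Import Order.TTheory GRing.Theory Num.Theory.
Import numFieldNormedType.Exports.

Set Implicit Arguments.
Unset Strict Implicit.
Unset Printing Implicit Defensive.

Local Open Scope classical_set_scope.
Local Open Scope ring_scope.

(** The penalty parameter can only grow by a fixed amount, so that a bounded
    sequence of penalty parameters is eventually a constant [p]; from then on
    every iteration either moves far enough or accepts a correction
    ([penalty_eventually_constant]).

    The inexact lower-level solutions are controlled by strong convexity: the
    distance to the exact solution [thetastar] is at most a constant times the
    residual ([residual_bound], [prox_step_bound]), and the residual tolerances
    are square summable because they contract up to the square summable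
    sequence [a_s] ([tol_sqr_sums]).

    The merit function [F / p + phi - v_gamma] is bounded below on [X * Y].
    Up to the lower-level errors, whose squares are summable, each proximal
    gradient step in [y] decreases it, since [v_gamma] is convex
    in [y] ([y_step_descent]); each projected gradient step in [x] decreases
    it, since [v_gamma] is weakly convex in [x] by joint weak convexity of
    [phi] and smallness of [gamma] ([vgamma_lower_x], [x_step_descent]); an
    accepted correction increases it by a summable amount at most
    ([correction_descent]).  Hence the squared steps are summable and the
    steps tend to zero ([Delta_cvg0]).

    Along a subsequence converging to [(xbar, ybar)] all the points entering
    two consecutive iterations therefore converge, with the lower-level
    approximations converging to [thetastar (xbar, ybar)], because [thetastar]
    is Lipschitz ([thetastar_lipschitz]).  The optimality conditions of the two
    steps pass to the limit ([y_stationary], [x_stationary]), and so does the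
    bound on the gap: when the algorithm moves, the constraint residual is
    dominated by the step, and after a correction the point is nearly a
    minimizer of [phi (x, _)] ([gap_bound], [limit_feasible]).

    The multiplier is [p] itself, and the relaxed level is the value of
    [phi - v_gamma] at the limit, which makes complementarity trivial.  The
    remaining point is that a partial subgradient of [g] in [y], together with
    the partial gradient in [x], is a subgradient of [g] on [X * Y]; this holds
    because the partial gradient in [x] is Lipschitz in both variables
    ([partial_subgradient]). *)

(** * Euclidean geometry of row vectors *)

Section Euclid.
Context {R : realType} {n : nat}.
Implicit Types u v w : 'rV[R]_n.

Lemma dotC u v : dot u v = dot v u.
Proof. by apply: eq_bigr => i _; rewrite mulrC. Qed.

Lemma dotDl u v w : dot (u + v) w = dot u w + dot v w.
Proof.
by rewrite /dot -big_split; apply: eq_bigr => i _; rewrite mxE mulrDl.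
Qed.

Lemma dotZl (a : R) u v : dot (a *: u) v = a * dot u v.
Proof. by rewrite /dot mulr_sumr; apply: eq_bigr => i _; rewrite mxE mulrA. Qed.

Lemma dotNl u v : dot (- u) v = - dot u v.
Proof. by rewrite -scaleN1r dotZl mulN1r. Qed.

Lemma dotDr u v w : dot u (v + w) = dot u v + dot u w.
Proof. by rewrite dotC dotDl !(dotC u). Qed.

Lemma dotZr (a : R) u v : dot u (a *: v) = a * dot u v.
Proof. by rewrite dotC dotZl (dotC u). Qed.

Lemma dotNr u v : dot u (- v) = - dot u v.
Proof. by rewrite dotC dotNl (dotC u). Qed.

Lemma dot0l u : dot 0 u = 0.
Proof. by rewrite -(scale0r u) dotZl mul0r. Qed.

Definition dotE := (dotDl, dotDr, dotNl, dotNr, dotZl, dotZr).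

Lemma dot_ge0 u : 0 <= dot u u.
Proof. by apply: sumr_ge0 => i _; rewrite -expr2 sqr_ge0. Qed.

Lemma enorm_ge0 u : 0 <= enorm u.
Proof. exact: sqrtr_ge0. Qed.

Lemma enorm_sqr u : enorm u ^+ 2 = dot u u.
Proof. by rewrite sqr_sqrtr ?dot_ge0. Qed.

Lemma enormN u : enorm (- u) = enorm u.
Proof. by rewrite /enorm dotNl dotNr opprK. Qed.

Lemma enorm_distC u v : enorm (u - v) = enorm (v - u).
Proof. by rewrite -enormN opprB. Qed.

Lemma enormZ (a : R) u : enorm (a *: u) = `|a| * enorm u.
Proof.
by rewrite /enorm dotZl dotZr mulrA -expr2 sqrtrM ?sqr_ge0// sqrtr_sqr.
Qed.

Lemma enorm0 : enorm (0 : 'rV[R]_n) = 0.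
Proof. by rewrite -(scale0r 0) enormZ normr0 mul0r. Qed.

Lemma coord_le_enorm u i : `|u 0 i| <= enorm u.
Proof.
rewrite -sqrtr_sqr ler_sqrt ?dot_ge0// /dot (bigD1 i)//= -expr2 lerDl.
by apply: sumr_ge0 => j _; rewrite -expr2 sqr_ge0.
Qed.

Lemma enorm_eq0 u : enorm u = 0 -> u = 0.
Proof.
move=> u0; apply/rowP => i; rewrite mxE; apply/eqP.
by rewrite -normr_le0 -u0 coord_le_enorm.
Qed.

(** The Cauchy-Schwarz inequality. *)
Lemma dot_le u v : dot u v <= enorm u * enorm v.
Proof.
have [/eqP/enorm_eq0 ->|u0] := boolP (enorm u == 0).
  by rewrite dot0l mulr_ge0 ?enorm_ge0.
have [/eqP/enorm_eq0 ->|v0] := boolP (enorm v == 0).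
  by rewrite dotC dot0l mulr_ge0 ?enorm_ge0.
have ab : 0 < enorm u * enorm v.
  by rewrite mulr_gt0 ?lt0r ?u0 ?v0 ?enorm_ge0.
have := dot_ge0 (enorm v *: u - enorm u *: v).
rewrite !dotE -!enorm_sqr (dotC v u) => h.
rewrite -subr_ge0 -(pmulr_rge0 _ (_ : 0 < 2 * (enorm u * enorm v)));
  last by lra.
by apply: le_trans h _; rewrite le_eqVlt; apply/orP; left; apply/eqP; ring.
Qed.

Lemma dot_ge u v : - (enorm u * enorm v) <= dot u v.
Proof. by rewrite lerNl -dotNl -(enormN u) dot_le. Qed.

Lemma enormD_le u v : enorm (u + v) <= enorm u + enorm v.
Proof.
rewrite -(ler_pXn2r (ltn0Sn 1)) ?nnegrE ?addr_ge0 ?enorm_ge0//.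
rewrite enorm_sqr !dotE (dotC v u) -!enorm_sqr.
have := dot_le u v; nra.
Qed.

Lemma enormB_le u v w : enorm (u - w) <= enorm (u - v) + enorm (v - w).
Proof. by rewrite -[u - w](subrKA v); exact: enormD_le. Qed.

Lemma cvg_dot {T : Type} {Fi : set_system T} {FF : Filter Fi}
    (f g : T -> 'rV[R]_n) u v :
  f @ Fi --> u -> g @ Fi --> v -> dot (f t) (g t) @[t --> Fi] --> dot u v.
Proof.
move=> fu gv; rewrite /dot; apply: cvg_big => [|i _].
  exact: add_continuous.
apply: cvgM.
  apply: (@cvg_comp _ _ _ f (fun x : 'rV[R]_n => x 0 i) _ _ _ fu).
  exact: coord_continuous.
apply: (@cvg_comp _ _ _ g (fun x : 'rV[R]_n => x 0 i) _ _ _ gv).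
exact: coord_continuous.
Qed.

Lemma cvg_enorm {T : Type} {Fi : set_system T} {FF : Filter Fi}
    (f : T -> 'rV[R]_n) u :
  f @ Fi --> u -> enorm (f t) @[t --> Fi] --> enorm u.
Proof.
move=> fu; apply: (@cvg_comp _ _ _ (fun t => dot (f t) (f t)) (@Num.sqrt R) _
    (nbhs (dot u u))); last exact: sqrt_continuous.
exact: cvg_dot.
Qed.

(** Here [`|u|] is the sup norm. *)
Lemma norm_le_enorm u : `|u| <= enorm u.
Proof.
rewrite /Num.norm/= mx_normrE; apply/bigmax_leP; split; first exact: enorm_ge0.
by move=> [i j] _ /=; rewrite ord1 coord_le_enorm.
Qed.

Lemma cvg_enorm_subP {Fi : set_system nat} {FF : Filter Fi}
    (f : nat -> 'rV[R]_n) u :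
  enorm (f t - u) @[t --> Fi] --> (0 : R) -> f @ Fi --> u.
Proof.
move=> /cvgrPdist_lt h; apply/cvgrPdist_lt => e e0.
apply: filterS (h _ e0) => t; rewrite sub0r normrN ger0_norm ?enorm_ge0//.
by move=> te; rewrite distrC; apply: le_lt_trans te; exact: norm_le_enorm.
Qed.

End Euclid.

Section ProductEuclid.
Context {R : realType} {n m : nat}.
Implicit Types z w : 'rV[R]_n * 'rV[R]_m.

Lemma pnorm_ge0 z : 0 <= pnorm z.
Proof. exact: sqrtr_ge0. Qed.

Lemma pnorm_sqr z : pnorm z ^+ 2 = enorm z.1 ^+ 2 + enorm z.2 ^+ 2.
Proof. by rewrite sqr_sqrtr ?addr_ge0 ?dot_ge0// /pdot -!enorm_sqr. Qed.

Lemma enorm1_le_pnorm z : enorm z.1 <= pnorm z.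
Proof. by rewrite ler_sqrt ?addr_ge0 ?dot_ge0// lerDl dot_ge0. Qed.

Lemma enorm2_le_pnorm z : enorm z.2 <= pnorm z.
Proof. by rewrite ler_sqrt ?addr_ge0 ?dot_ge0// lerDr dot_ge0. Qed.

Lemma pnorm_pair0 (x : 'rV[R]_n) : pnorm (x, 0 : 'rV[R]_m) = enorm x.
Proof. by rewrite /pnorm /pdot /= -(enorm_sqr 0) enorm0 expr0n addr0. Qed.

Lemma pnorm_0pair (y : 'rV[R]_m) : pnorm (0 : 'rV[R]_n, y) = enorm y.
Proof. by rewrite /pnorm /pdot /= -(enorm_sqr 0) enorm0 expr0n add0r. Qed.

Lemma cvg_pnorm {T : Type} {Fi : set_system T} {FF : Filter Fi}
    (f : T -> 'rV[R]_n * 'rV[R]_m) z :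
  f @ Fi --> z -> pnorm (f t) @[t --> Fi] --> pnorm z.
Proof.
move=> fz.
have f1 : (f t).1 @[t --> Fi] --> z.1 by apply: cvg_comp fz _; exact: cvg_fst.
have f2 : (f t).2 @[t --> Fi] --> z.2 by apply: cvg_comp fz _; exact: cvg_snd.
apply: (@cvg_comp _ _ _ (fun t => pdot (f t) (f t)) (@Num.sqrt R) _
    (nbhs (pdot z z))); last exact: sqrt_continuous.
by apply: cvgD; exact: cvg_dot.
Qed.

End ProductEuclid.

(** * Convex functions and proximal points *)

(** Convexity of a real function along the segments of a set, with the moving
    point written as [a + t *: (b - a)]. *)
Definition convex_on {R : realType} {V : lmodType R} (D : set V) (h : V -> R) :=
  forall a b t, D a -> D b -> 0 <= t <= 1 ->
    h (a + t *: (b - a)) <= (1 - t) * h a + t * h b.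

Section Convexity.
Context {R : realType}.

Lemma convE {V : lmodType R} (a b : V) (t : R) :
  a + t *: (b - a) = (1 - t) *: a + t *: b.
Proof. by rewrite scalerBr scalerBl scale1r addrCA addrC. Qed.

Lemma convex_set_seg {V : lmodType R} (D : set V) (a b : V) (t : R) :
  convex_set D -> D a -> D b -> 0 <= t <= 1 -> D (a + t *: (b - a)).
Proof.
move=> cD Da Db /andP[t0 t1].
have /set_mem := cD b a (Itv01 t0 t1) (mem_set Db) (mem_set Da).
by rewrite convE addrC.
Qed.

Lemma convex_function_on {V : lmodType R} (D : set V) (h : V -> R) :
  convex_function D h -> convex_on D h.
Proof.
move=> ch a b t Da Db /andP[t0 t1].
have := ch (Itv01 t0 t1) b a (mem_set Db) (mem_set Da).
rewrite convRE/= [in leRHS]addrC convE => H.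
by apply: le_trans H; rewrite [in leLHS]addrC.
Qed.

Lemma convex_onD {V : lmodType R} (D : set V) (h1 h2 : V -> R) :
  convex_on D h1 -> convex_on D h2 -> convex_on D (fun v => h1 v + h2 v).
Proof.
move=> c1 c2 a b t Da Db t01.
by have := lerD (c1 a b t Da Db t01) (c2 a b t Da Db t01); lra.
Qed.

Lemma convex_onZ {V : lmodType R} (D : set V) (h : V -> R) (c : R) :
  0 <= c -> convex_on D h -> convex_on D (fun v => c * h v).
Proof.
move=> c0 ch a b t Da Db t01.
by have := ler_wpM2l c0 (ch a b t Da Db t01); lra.
Qed.

(** Comparison of slopes up to a quadratic remainder, which is negligible as
    [t] tends to zero. *)
Lemma ler_first_order (A B C : R) :
  (forall t, 0 < t <= 1 -> t * B - C * t ^+ 2 <= t * A) -> B <= A.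
Proof.
move=> h; rewrite leNgt; apply/negP => AB.
have C1 : 0 < 2 * (`|C| + 1) by rewrite mulr_gt0// ltr_wpDl.
pose t := Num.min 1 ((B - A) / (2 * (`|C| + 1))).
have t0 : 0 < t by rewrite lt_min ltr01 divr_gt0 ?subr_gt0.
have t1 : t <= 1 by rewrite ge_min lexx.
have tBA : t * (2 * (`|C| + 1)) <= B - A.
  by rewrite -ler_pdivlMr// ge_min lexx orbT.
have := h t; rewrite t0 t1 => /(_ isT).
have Cle : C <= `|C| by exact: ler_norm.
have -> : t * B - C * t ^+ 2 = t * (B - C * t) by ring.
rewrite ler_pM2l// => hB.
by nra.
Qed.

End Convexity.

Section ProximalPoint.
Context {R : realType} {m : nat}.
Variables (Y : set 'rV[R]_m) (h : 'rV[R]_m -> R).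
Hypothesis cY : closed Y.
Hypothesis ccY : convex_set Y.
Hypothesis Y0 : Y !=set0.
Hypothesis hc : convex_on Y h.
Hypothesis hcont : {within Y, continuous h}.

(** Near a point [y0] of [Y] the function is bounded below; convexity
    propagates the bound linearly along the rays issued from [y0]. *)
Lemma convex_linear_minorant y0 : Y y0 ->
  exists2 C, 0 <= C & forall u, Y u -> h y0 - C - C * enorm (u - y0) <= h u.
Proof.
move=> Yy0.
have /cvgrPdist_lt/(_ 1 ltr01) :=
  (@subspace_continuousP _ Y _ h).1 hcont y0 Yy0.
move=> /nbhs_ballP[d /= d0 hd].
have hd' u : Y u -> enorm (u - y0) < d -> h y0 - 1 <= h u.
  move=> Yu ud.
  have := hd u; rewrite /= => /(_ _ Yu) h1.
  have /h1 : ball y0 d u.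
    rewrite -ball_normE/= distrC; apply: le_lt_trans ud; exact: norm_le_enorm.
  by rewrite ltr_distlC => /andP[/ltW + _]; lra.
exists (Num.max 1 (2 / d)); first by rewrite le_max ler01.
move=> u Yu; set C := Num.max _ _; set r := enorm (u - y0).
have r0 : 0 <= r by exact: enorm_ge0.
have C1 : 1 <= C by rewrite le_max lexx.
have C0 : 0 <= C by lra.
have Cr : 0 <= C * r by exact: mulr_ge0.
have [rd|dr] := ltP r d; first by have := hd' u Yu rd; lra.
have r_gt0 : 0 < r by apply: lt_le_trans dr.
pose t := d / 2 / r.
have t0 : 0 < t by rewrite !divr_gt0.
have t1 : t <= 1 by rewrite ler_pdivrMr// mul1r; lra.
have t01 : 0 <= t <= 1 by rewrite (ltW t0).
have Yw := convex_set_seg ccY Yy0 Yu t01.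
have := hc Yy0 Yu t01.
have : enorm (y0 + t *: (u - y0) - y0) < d.
  rewrite addrAC subrr add0r enormZ gtr0_norm// -/r divfK ?gt_eqF//; lra.
move=> /(hd' _ Yw) h1 h2.
have h3 : t * (h y0 - h u) <= 1 by lra.
have Ct : 1 <= t * (C * r).
  rewrite mulrCA (divfK (lt0r_neq0 r_gt0)).
  have : 2 / d <= C by rewrite le_max lexx orbT.
  by rewrite ler_pdivrMr// => ?; lra.
suff : h y0 - h u <= C * r by lra.
by rewrite -(ler_pM2l t0); apply: le_trans h3 Ct.
Qed.

(** Existence of proximal points. *)
Lemma prox_exists (mu : R) (v : 'rV[R]_m) : 0 < mu ->
  exists u, Y u /\ forall w, Y w ->
    h u + mu * enorm (u - v) ^+ 2 <= h w + mu * enorm (w - v) ^+ 2.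
Proof.
move=> mu0; have [y0 Yy0] := Y0.
have [C C0 hC] := convex_linear_minorant Yy0.
pose q u := h u + mu * enorm (u - v) ^+ 2.
pose r0 := enorm (y0 - v).
(* B is chosen so that outside the ball of radius B around v the quadratic
   term beats the linear minorant, hence the minimum over Y is attained on
   the compact set S. *)
pose B := r0 + 1 + C / mu + (C + C * r0 + mu * r0 ^+ 2) / mu.
pose S := Y `&` [set u | enorm (u - v) <= B].
have r00 : 0 <= r0 by exact: enorm_ge0.
have Cr0 : 0 <= C * r0 by exact: mulr_ge0.
have mr0 : 0 <= mu * r0 ^+ 2 by rewrite mulr_ge0 ?sqr_ge0// ltW.
have Cm : 0 <= C / mu by rewrite divr_ge0// ltW.
have D0 : 0 <= (C + C * r0 + mu * r0 ^+ 2) / mu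
  by apply: divr_ge0; [lra|exact: ltW].
have contE : continuous (fun u : 'rV[R]_m => enorm (u - v)).
  move=> u; apply: (@cvg_enorm R m _ (nbhs u) _ (fun x => x - v)).
  by apply: cvgB; [exact: cvg_id|exact: cvg_cst].
have Sy0 : S y0 by split => //=; rewrite -/r0 /B; lra.
have Sc : compact S.
  apply: bounded_closed_compact.
    exists (B + enorm v); split; first exact: num_real.
    move=> M BM u [_ /= uB]; apply: le_trans (ltW BM).
    apply: le_trans (norm_le_enorm _) _.
    have := enormD_le (u - v) v; rewrite subrK => h1.
    by apply: le_trans h1 _; rewrite lerD2r.
  apply: closedI => //.
  exact: ((continuous_closedP (fun u : 'rV[R]_m => enorm (u - v))).1 contE
    [set x : R | x <= B] (@closed_le _ B)).
have qc : {within S, continuous q}.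
  have cw : {within Y, continuous q}.
    move=> u; apply: cvgD; first exact: hcont.
    apply: cvgM; first exact: cvg_cst.
    apply: cvgM; exact: (continuous_subspaceT contE).
  by apply: continuous_subspaceW cw => u [].
have [u uS hu] := EVT_min_rV (ex_intro _ _ Sy0) Sc qc.
move: uS; rewrite inE => -[Yu uB]; exists u; split => // w Yw.
have [wB|wB] := leP (enorm (w - v)) B.
  by apply: hu; rewrite inE.
have h1 : q u <= q y0 by apply: hu; rewrite inE.
apply: le_trans h1 _; rewrite /q.
have h2 := hC w Yw.
have h3 : C * enorm (w - y0) <= C * (enorm (w - v) + r0).
  by apply: ler_wpM2l => //; rewrite /r0 (enorm_distC y0 v); exact: enormB_le.
rewrite -/r0; set s := enorm (w - v) in wB h3 *.
have h4 : mu * B <= mu * s by rewrite ler_pM2l// ltW.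
have muB : mu * B = mu * (r0 + 1) + C + (C + C * r0 + mu * r0 ^+ 2).
  by rewrite /B; field; rewrite gt_eqF.
have s1 : 1 <= s by move: wB; rewrite /B; lra.
have mr : 0 <= mu * (r0 + 1) by apply: mulr_ge0; lra.
have h5 : C * s + (C + C * r0 + mu * r0 ^+ 2) <= mu * s * s by nra.
by rewrite expr2; lra.
Qed.

(** First-order characterization of a proximal point. *)
Lemma prox_variational (mu : R) (v u : 'rV[R]_m) : Y u ->
  (forall w, Y w ->
    h u + mu * enorm (u - v) ^+ 2 <= h w + mu * enorm (w - v) ^+ 2) ->
  forall w, Y w -> h u + 2 * mu * dot (v - u) (w - u) <= h w.
Proof.
move=> Yu umin w Yw.
suff : 2 * mu * dot (v - u) (w - u) <= h w - h u by lra.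
apply: (@ler_first_order _ _ _ (mu * enorm (w - u) ^+ 2)) => t /andP[t0 t1].
have t01 : 0 <= t <= 1 by rewrite ltW.
have h1 := umin _ (convex_set_seg ccY Yu Yw t01).
have h2 := hc Yu Yw t01.
have h3 : enorm (u + t *: (w - u) - v) ^+ 2 = enorm (u - v) ^+ 2
    - 2 * t * dot (v - u) (w - u) + t ^+ 2 * enorm (w - u) ^+ 2.
  rewrite addrAC !enorm_sqr -(opprB u v) !dotE.
  by rewrite (dotC w u) (dotC w v) (dotC u v); ring.
by rewrite h3 in h1; lra.
Qed.

End ProximalPoint.

(** * Proximal map, projection and descent inequalities *)

Section ProxProj.
Context {R : realType} {m : nat}.

(** The argmin set defining [Prox] is nonempty, so that [Prox] does return a
    minimizer; this minimizer lies in [Y] because the function is infinite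
    elsewhere. *)
Lemma Prox_indicator (Y : set 'rV[R]_m) (h : 'rV[R]_m -> R) (v : 'rV[R]_m)
    (u := Prox (fun w => ((h w)%:E + indicator_fun R Y w)%E) v) :
  closed Y -> convex_set Y -> Y !=set0 -> convex_on Y h ->
  {within Y, continuous h} ->
  Y u /\ forall w, Y w -> h u + dot (v - u) (w - u) <= h w.
Proof.
move=> cY ccY Y0 hc hcont.
have half0 : 0 < 2^-1 :> R by rewrite invr_gt0.
have [u0 [Yu0 u0min]] := prox_exists cY ccY Y0 hc hcont v half0.
set ht := (fun w => ((h w)%:E + indicator_fun R Y w)%E) in u *.
pose A := [set th | forall w,
    (ht th + (2^-1 * enorm (th - v) ^+ 2)%:E <=
     ht w + (2^-1 * enorm (w - v) ^+ 2)%:E)%E].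
have htY w : Y w -> ht w = (h w)%:E.
  by move=> Yw; rewrite /ht /indicator_fun mem_set// adde0.
have htN w : ~ Y w -> ht w = +oo%E.
  by move=> Yw; rewrite /ht /indicator_fun memNset.
have Au0 : A u0.
  move=> w; rewrite htY//; have [Yw|nYw] := pselect (Y w).
    by rewrite htY// -!EFinD lee_fin u0min.
  by rewrite (htN w)// addye// leey.
have Au : A u by exact: (@getPex _ A (ex_intro _ _ Au0)).
have Yu : Y u.
  apply: contrapT => nYu; have := Au u0.
  by rewrite htN// addye// htY// -EFinD leye_eq.
split => // w Yw.
have umin w' : Y w' -> h u + 2^-1 * enorm (u - v) ^+ 2 <=
    h w' + 2^-1 * enorm (w' - v) ^+ 2.
  by move=> Yw'; have := Au w'; rewrite !htY// -!EFinD lee_fin.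
have := prox_variational ccY hc Yu umin Yw.
by rewrite mulfV ?mul1r.
Qed.

Lemma Proj_variational (X : set 'rV[R]_m) (z : 'rV[R]_m) :
  closed X -> convex_set X -> X !=set0 ->
  X (Proj X z) /\ forall w, X w -> dot (z - Proj X z) (w - Proj X z) <= 0.
Proof.
move=> cX ccX X0.
have h0 : convex_on X (fun=> 0 : R)
  by move=> a b t _ _ _; rewrite /= !mulr0 addr0.
have h0c : {within X, continuous (fun=> 0 : R)}.
  by apply: continuous_subspaceT; exact: cst_continuous.
have [u0 [Xu0 u0min]] := prox_exists cX ccX X0 h0 h0c z ltr01.
pose A := [set u | X u /\ forall v, X v -> enorm (u - z) <= enorm (v - z)].
have Au0 : A u0.
  split => // v Xv; have := u0min v Xv; rewrite !mul1r !add0r.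
  by rewrite ler_pXn2r// ?nnegrE ?enorm_ge0.
have [Xu umin] : A (Proj X z) by exact: (@getPex _ A (ex_intro _ _ Au0)).
split => // w Xw.
have umin' w' : X w' -> 0 + 1 * enorm (Proj X z - z) ^+ 2 <=
    0 + 1 * enorm (w' - z) ^+ 2.
  move=> Xw'; rewrite !mul1r !add0r ler_pXn2r ?nnegrE ?enorm_ge0//.
  exact: umin.
by have := prox_variational ccX h0 Xu umin' Xw; lra.
Qed.

End ProxProj.

Section Calculus.
Context {R : realType} {n : nat}.
Implicit Types x v : 'rV[R]_n.

(** Directional derivatives are read off the vector of partial derivatives. *)
Lemma derive_grad (h : 'rV[R]_n -> R) x v :
  differentiable h x -> 'D_v h x = dot (grad h x) v.
Proof.
move=> dh; rewrite deriveE// {1}(row_sum_delta v) linear_sum.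
by apply: eq_bigr => i _; rewrite linearZ /= mxE deriveE// mulrC.
Qed.

Lemma gradD (h1 h2 : 'rV[R]_n -> R) x :
  differentiable h1 x -> differentiable h2 x ->
  grad (fun w => h1 w + h2 w) x = grad h1 x + grad h2 x.
Proof.
move=> d1 d2; apply/rowP => i; rewrite !mxE.
by rewrite (@deriveD _ _ _ h1 h2)//; exact: diff_derivable.
Qed.

Lemma is_derive_line (h : 'rV[R]_n -> R) x v (t : R) :
  differentiable h (x + t *: v) ->
  is_derive t 1 (fun s : R => h (x + s *: v)) (dot (grad h (x + t *: v)) v).
Proof.
move=> dh; rewrite -derive_grad//.
have E : (fun k : R =>
      k^-1 *: (((fun s : R => h (x + s *: v)) \o shift t) (k *: 1)
        - h (x + t *: v))) =
    (fun k : R => k^-1 *: ((h \o shift (x + t *: v)) (k *: v)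
        - h (x + t *: v))).
  apply/funext => k; congr (_ *: (h _ - _)).
  by rewrite /= scalerDl addrCA [k *: 1]mulr1.
split; first by rewrite /derivable E; exact: diff_derivable.
by rewrite /derive E.
Qed.

(** The mean value theorem for an affine bound on the derivative. *)
Lemma is_derive_increment (f df : R -> R) (a b : R) :
  (forall t : R, 0 <= t <= 1 -> is_derive t 1 f (df t)) ->
  (forall t, 0 <= t <= 1 -> df t <= a + b * t) ->
  f 1 - f 0 <= a + b / 2.
Proof.
move=> fd dle.
pose r (t : R) := f t - (a * t + b / 2 * t ^+ 2).
have rd (t : R) : 0 <= t <= 1 -> is_derive t 1 r (df t - (a + b * t)).
  move=> t01; have := fd t t01 => ft.
  have -> : r = f - ((a \*: (id : R -> R))
      + ((b / 2) \*: ((id : R -> R) ^+ 2))).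
    by apply/funext => s; rewrite /r !fctE /GRing.scale /=.
  by apply: is_derive_eq; rewrite /GRing.scale /= expr1; field.
have [||c c01 hc] := @MVT R r (fun t => df t - (a + b * t)) 0 1 ltr01.
- by move=> s; rewrite in_itv/= => /andP[t0 t1]; apply: rd; rewrite !ltW.
- apply: derivable_within_continuous => s; rewrite in_itv/= => t01.
  by have [] := rd s t01.
have c01' : 0 <= c <= 1.
  by move: c01; rewrite in_itv/= => /andP[c0 c1]; rewrite !ltW.
by have := dle c c01'; move: hc; rewrite /r; lra.
Qed.

Section FirstOrder.
Variables (D : set 'rV[R]_n).
Hypothesis cD : convex_set D.

(** First-order expansion on a convex set with a quadratic error, when
    the variation of the gradient from the base point [x] is at most linear. *)
Lemma descent (h : 'rV[R]_n -> R) (L : R) x x' :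
  (forall w, D w -> differentiable h w) ->
  (forall w, D w -> enorm (grad h w - grad h x) <= L * enorm (w - x)) ->
  D x -> D x' ->
  `|h x' - h x - dot (grad h x) (x' - x)| <= L / 2 * enorm (x' - x) ^+ 2.
Proof.
move=> dh Lh Dx Dx'; set v := x' - x.
have Dt t : 0 <= t <= 1 -> D (x + t *: v) by exact: convex_set_seg.
have x1 : x + (1 : R) *: v = x' by rewrite scale1r addrC subrK.
have x0 : x + (0 : R) *: v = x by rewrite scale0r addr0.
have grad_le t : 0 <= t <= 1 ->
    `|dot (grad h (x + t *: v)) v - dot (grad h x) v| <= L * enorm v ^+ 2 * t.
  move=> t01; have /andP[t0 _] := t01.
  have := Lh _ (Dt t t01); rewrite (addrC x) addrK enormZ (ger0_norm t0) => hL.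
  rewrite -dotNl -dotDl; set w := _ - _ in hL *.
  have le1 : enorm w * enorm v <= L * (t * enorm v) * enorm v.
    by apply: ler_wpM2r => //; exact: enorm_ge0.
  have := dot_le w v; have := dot_ge w v; rewrite ler_norml; lra.
have hd (t : R) : 0 <= t <= 1 ->
    is_derive t 1 (fun s => h (x + s *: v)) (dot (grad h (x + t *: v)) v).
  by move=> t01; apply: is_derive_line; exact/dh/Dt.
have hdN (t : R) : 0 <= t <= 1 ->
    is_derive t 1 (- (fun s => h (x + s *: v))) (- dot (grad h (x + t *: v)) v).
  by move=> /hd ?; exact: is_deriveN.
have := @is_derive_increment _ _ (dot (grad h x) v) (L * enorm v ^+ 2) hd.
have := @is_derive_increment _ _ (- dot (grad h x) v) (L * enorm v ^+ 2) hdN.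
rewrite !fctE x1 x0 => lo up.
have {}lo : - h x' - - h x <= - dot (grad h x) v + L * enorm v ^+ 2 / 2.
  apply: lo => t /grad_le; rewrite ler_norml => /andP[? ?]; lra.
have {}up : h x' - h x <= dot (grad h x) v + L * enorm v ^+ 2 / 2.
  apply: up => t /grad_le; rewrite ler_norml => /andP[? ?]; lra.
by rewrite ler_norml; apply/andP; split; lra.
Qed.

(** The increments of two functions with close gradients are close. *)
Lemma increment_diff_le (h1 h2 : 'rV[R]_n -> R) (M : R) x x' :
  (forall w, D w -> differentiable h1 w) ->
  (forall w, D w -> differentiable h2 w) ->
  (forall w, D w -> enorm (grad h1 w - grad h2 w) <= M) ->
  D x -> D x' ->
  (h1 x' - h1 x) - (h2 x' - h2 x) <= M * enorm (x' - x).
Proof.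
move=> d1 d2 M12 Dx Dx'; set v := x' - x.
have Dt t : 0 <= t <= 1 -> D (x + t *: v) by exact: convex_set_seg.
have x1 : x + (1 : R) *: v = x' by rewrite scale1r addrC subrK.
have x0 : x + (0 : R) *: v = x by rewrite scale0r addr0.
have hd (t : R) : 0 <= t <= 1 -> is_derive t 1
    ((fun s => h1 (x + s *: v)) - (fun s => h2 (x + s *: v)))
    (dot (grad h1 (x + t *: v)) v - dot (grad h2 (x + t *: v)) v).
  move=> t01; apply: is_deriveB; apply: is_derive_line.
    exact/d1/Dt.
  exact/d2/Dt.
have := @is_derive_increment _ _ (M * enorm v) 0 hd.
rewrite !fctE x1 x0 mul0r addr0 => h12.
suff : h1 x' - h2 x' - (h1 x - h2 x) <= M * enorm v by lra.
apply: h12 => t /Dt Dtt; rewrite mul0r addr0 -dotNl -dotDl.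
apply: le_trans (dot_le _ _) _; apply: ler_wpM2r; first exact: enorm_ge0.
exact: M12.
Qed.

Lemma convex_first_order (h : 'rV[R]_n -> R) (L : R) x x' :
  (forall w, D w -> differentiable h w) ->
  (forall w, D w -> enorm (grad h w - grad h x) <= L * enorm (w - x)) ->
  convex_on D h -> D x -> D x' ->
  h x + dot (grad h x) (x' - x) <= h x'.
Proof.
move=> dh Lh ch Dx Dx'.
suff : dot (grad h x) (x' - x) <= h x' - h x by lra.
apply: (@ler_first_order _ _ _ (L / 2 * enorm (x' - x) ^+ 2)) => t /andP[t0 t1].
have t01 : 0 <= t <= 1 by rewrite ltW.
have := descent dh Lh Dx (convex_set_seg cD Dx Dx' t01).
rewrite (addrC x) addrK dotZr enormZ (gtr0_norm t0) ler_norml => /andP[lo _].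
by have := ch x x' t Dx Dx' t01; rewrite (addrC x); lra.
Qed.

End FirstOrder.

End Calculus.

Section PartialDifferential.
Context {R : realType} {n m : nat}.

Lemma differentiable_pair_l (h : 'rV[R]_n * 'rV[R]_m -> R) x y :
  differentiable h (x, y) -> differentiable (fun x' => h (x', y)) x.
Proof.
by move=> dh; apply: (@differentiable_comp _ _ _ _ (fun x' => (x', y)) h).
Qed.

Lemma differentiable_pair_r (h : 'rV[R]_n * 'rV[R]_m -> R) x y :
  differentiable h (x, y) -> differentiable (fun y' => h (x, y')) y.
Proof.
by move=> dh; apply: (@differentiable_comp _ _ _ _ (fun y' => (x, y')) h).
Qed.

End PartialDifferential.

(** * The lower-level problem and its Moreau envelope *)

Section ProxAlgebra.
Context {R : realType} {m : nat}.
Implicit Types u v w : 'rV[R]_m.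

Lemma sqr_enorm_shift u v w :
  enorm (w - v) ^+ 2 =
  enorm (u - v) ^+ 2 - 2 * dot (v - u) (w - u) + enorm (w - u) ^+ 2.
Proof.
by rewrite !enorm_sqr !dotE (dotC w v) (dotC w u) (dotC u v); ring.
Qed.

(** Objective gap after a proximal gradient step from [th] to [p], compared
    with any point [t]: the step [th - p], the gradient variation [D' - D] and
    the quadratic term together form a subgradient at [p]. *)
Lemma prox_gradient_gap (th p t y D D' : 'rV[R]_m) (fp ft gp gt eta gam L : R) :
  0 < eta -> 0 < gam ->
  gp + eta^-1 * dot (th - eta *: (D + gam^-1 *: (th - y)) - p) (t - p) <= gt ->
  fp + dot D' (t - p) <= ft ->
  enorm (D' - D) <= L * enorm (th - p) ->
  (fp + gp + (2 * gam)^-1 * enorm (p - y) ^+ 2)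
    - (ft + gt + (2 * gam)^-1 * enorm (t - y) ^+ 2)
    + (2 * gam)^-1 * enorm (p - t) ^+ 2
  <= (eta^-1 + L + gam^-1) * enorm (th - p) * enorm (p - t).
Proof.
move=> eta0 gam0 hg hf hD.
rewrite (sqr_enorm_shift p y t) (enorm_distC p t).
set v := t - p in hg hf *.
have hv : - ((eta^-1 + L + gam^-1) * enorm (th - p) * enorm v) <=
    dot (eta^-1 *: (th - p) + (D' - D) - gam^-1 *: (th - p)) v.
  apply: le_trans (dot_ge _ _); rewrite lerN2.
  apply: ler_wpM2r; first exact: enorm_ge0.
  apply: le_trans (enormD_le _ _) _; rewrite enormN mulrDl; apply: lerD.
    apply: le_trans (enormD_le _ _) _; rewrite mulrDl; apply: lerD => //.
    by rewrite enormZ ger0_norm// invr_ge0 ltW.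
  by rewrite enormZ ger0_norm// invr_ge0 ltW.
have E1 : eta^-1 * dot (th - eta *: (D + gam^-1 *: (th - y)) - p) v =
    eta^-1 * (dot th v - dot p v) - dot D v - 2 * (2 * gam)^-1 *
    (dot th v - dot y v).
  by rewrite !(dotDl, dotNl, dotZl); field; rewrite !gt_eqF.
have E2 : dot (eta^-1 *: (th - p) + (D' - D) - gam^-1 *: (th - p)) v =
    eta^-1 * (dot th v - dot p v) + (dot D' v - dot D v) -
    2 * (2 * gam)^-1 * (dot th v - dot p v).
  by rewrite !(dotDl, dotNl, dotZl); field; rewrite !gt_eqF.
have E3 : dot (y - p) v = dot y v - dot p v by rewrite dotDl dotNl.
rewrite {}E1 in hg; rewrite {}E2 in hv; rewrite {}E3; clearbody v.
by move: (_^-1) (_^-1) hv hg => mu ei; lra.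
Qed.

End ProxAlgebra.

Section LowerLevel.
Context {R : realType} {n m : nat}.
Variables (P : bilevel R n m) (c : constants R) (a : agils_param R).
Hypothesis hP : standing P c.
Hypothesis Y0 : bY P !=set0.
Let X := bX P.
Let Y := bY P.
Let f := bf P.
Let g := bg P.
Let phi := bphi P.
Let gam := a_gam a.
Hypothesis gam0 : 0 < gam.

Lemma f_diff_x x y : X x -> Y y -> differentiable (fun x' => f (x', y)) x.
Proof.
by move=> Xx Yy; apply: differentiable_pair_l; apply: (f_C1 hP).1.
Qed.

Lemma f_diff_y x y : X x -> Y y -> differentiable (fun y' => f (x, y')) y.
Proof.
by move=> Xx Yy; apply: differentiable_pair_r; apply: (f_C1 hP).1.
Qed.

Lemma gradx_phi x y : X x -> Y y ->
  gradx phi (x, y) = gradx f (x, y) + gradx g (x, y).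
Proof.
move=> Xx Yy; apply: gradD; first exact: f_diff_x.
exact: g_differentiable_x hP _ _ Xx Yy.
Qed.

Lemma phi_diff_x x y : X x -> Y y -> differentiable (fun x' => phi (x', y)) x.
Proof.
move=> Xx Yy; apply: (@differentiableD _ _ _ (fun x' => f (x', y))
  (fun x' => g (x', y))).
  exact: f_diff_x.
exact: g_differentiable_x hP _ _ Xx Yy.
Qed.

Lemma lipschitz_x (q : nat) (G : 'rV[R]_n * 'rV[R]_m -> 'rV[R]_q) L x x' y :
  lipschitz_onE (bXY P) L G -> X x -> X x' -> Y y ->
  enorm (G (x', y) - G (x, y)) <= L * enorm (x' - x).
Proof.
move=> LG Xx Xx' Yy; have := LG (x', y) (x, y) (conj Xx' Yy) (conj Xx Yy).
by rewrite (_ : (x', y) - (x, y) = (x' - x, y - y))// subrr pnorm_pair0.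
Qed.

Lemma lipschitz_y (q : nat) (G : 'rV[R]_n * 'rV[R]_m -> 'rV[R]_q) L x y y' :
  lipschitz_onE (bXY P) L G -> X x -> Y y -> Y y' ->
  enorm (G (x, y') - G (x, y)) <= L * enorm (y' - y).
Proof.
move=> LG Xx Yy Yy'; have := LG (x, y') (x, y) (conj Xx Yy') (conj Xx Yy).
by rewrite (_ : (x, y') - (x, y) = (x - x, y' - y))// subrr pnorm_0pair.
Qed.

Lemma gradx_phi_lip_x x x' y : X x -> X x' -> Y y ->
  enorm (gradx phi (x', y) - gradx phi (x, y)) <=
    (Lfx c + Lg1 c) * enorm (x' - x).
Proof.
move=> Xx Xx' Yy; rewrite !gradx_phi// opprD addrACA mulrDl.
apply: le_trans (enormD_le _ _) _; apply: lerD.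
  exact: lipschitz_x (gradxf_lipschitz hP) Xx Xx' Yy.
exact: gradxg_lipschitz_x hP _ _ _ Yy Xx' Xx.
Qed.

Lemma gradx_phi_lip_y x y y' : X x -> Y y -> Y y' ->
  enorm (gradx phi (x, y') - gradx phi (x, y)) <=
    (Lfx c + Lg2 c) * enorm (y' - y).
Proof.
move=> Xx Yy Yy'; rewrite !gradx_phi// opprD addrACA mulrDl.
apply: le_trans (enormD_le _ _) _; apply: lerD.
  exact: lipschitz_y (gradxf_lipschitz hP) Xx Yy Yy'.
exact: gradxg_lipschitz_y hP _ _ _ Xx Yy' Yy.
Qed.

Lemma g_convex_on x : X x -> convex_on Y (fun y => g (x, y)).
Proof. by move=> Xx; apply: convex_function_on; exact: g_convex_y hP _ Xx. Qed.

Lemma f_convex_on x : X x -> convex_on Y (fun y => f (x, y)).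
Proof. by move=> Xx; apply: convex_function_on; exact: f_convex_y hP _ Xx. Qed.

Lemma phi_convex_on x : X x -> convex_on Y (fun y => phi (x, y)).
Proof.
by move=> Xx; apply: convex_onD; [exact: f_convex_on|exact: g_convex_on].
Qed.

Lemma phi_within : {within bXY P, continuous phi}.
Proof.
apply/subspace_continuousP => z XYz; apply: cvgD.
  apply: cvg_within_filter; apply: differentiable_continuous.
  exact: (f_C1 hP).1.
exact: (@subspace_continuousP _ _ _ _).1 (g_continuous hP) z XYz.
Qed.

Lemma within_section (h : 'rV[R]_n * 'rV[R]_m -> R) x : X x ->
  {within bXY P, continuous h} -> {within Y, continuous (fun y => h (x, y))}.
Proof.
move=> Xx hc; apply/subspace_continuousP => y Yy.
apply: cvg_comp ((@subspace_continuousP _ _ _ _).1 hc (x, y) (conj Xx Yy)).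
move=> A /= [[B1 B2] [/= nB1 nB2] BA].
rewrite /fmap /within /=; apply: filterS nB2 => y' B2y' Yy'.
by apply: (BA (x, y')) => //; split => //=; exact: nbhs_singleton.
Qed.

Lemma f_first_order x y y' : X x -> Y y -> Y y' ->
  f (x, y) + dot (grady f (x, y)) (y' - y) <= f (x, y').
Proof.
move=> Xx Yy Yy'.
apply: (@convex_first_order _ _ Y (Y_convex hP) (fun u => f (x, u))
  (Lfy c)) => //.
- by move=> w Yw; exact: f_diff_y.
- by move=> w Yw; exact: lipschitz_y (gradyf_lipschitz hP) Xx Yy Yw.
- exact: f_convex_on.
Qed.

(** The proximal lower-level objective, whose minimum over [Y] is the value
    of the Moreau envelope [vgamma]. *)
Definition lower_obj (x : 'rV[R]_n) (y th : 'rV[R]_m) : R :=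
  phi (x, th) + (2 * gam)^-1 * enorm (th - y) ^+ 2.

Local Notation thetas x y := (thetastar P gam (x, y)).

Let mu0 : 0 < (2 * gam)^-1. Proof. by rewrite invr_gt0 mulr_gt0. Qed.

Lemma thetastar_min x y : X x ->
  Y (thetas x y) /\
  forall w, Y w -> lower_obj x y (thetas x y) <= lower_obj x y w.
Proof.
move=> Xx.
have [u [Yu umin]] := prox_exists (Y_closed hP) (Y_convex hP) Y0
  (phi_convex_on Xx) (within_section Xx phi_within) y mu0.
exact: (@getPex _ [set th | Y th /\ forall th', Y th' ->
  lower_obj x y th <= lower_obj x y th'] (ex_intro _ u (conj Yu umin))).
Qed.

Lemma thetastar_in x y : X x -> Y (thetas x y).
Proof. by move=> Xx; have [] := thetastar_min y Xx. Qed.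

Lemma thetastar_variational x y w : X x -> Y w ->
  phi (x, thetas x y) + gam^-1 * dot (y - thetas x y) (w - thetas x y)
    <= phi (x, w).
Proof.
move=> Xx Yw; have [Yt tmin] := thetastar_min y Xx.
have := prox_variational (Y_convex hP) (phi_convex_on Xx) Yt tmin Yw.
by rewrite (_ : 2 * (2 * gam)^-1 = gam^-1)//; field; rewrite gt_eqF.
Qed.

(** Quadratic growth around the minimizer. *)
Lemma thetastar_strong_min x y w : X x -> Y w ->
  lower_obj x y (thetas x y) + (2 * gam)^-1 * enorm (w - thetas x y) ^+ 2
    <= lower_obj x y w.
Proof.
move=> Xx Yw; have := thetastar_variational y Xx Yw.
rewrite /lower_obj (sqr_enorm_shift (thetas x y) y w) => h1.
have E : gam^-1 = 2 * (2 * gam)^-1 by field; rewrite gt_eqF.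
by rewrite E in h1; lra.
Qed.

Lemma vgammaE x y : X x -> vgamma P gam (x, y) = lower_obj x y (thetas x y).
Proof.
move=> Xx; have [Yt tmin] := thetastar_min y Xx.
apply/eqP; rewrite eq_le; apply/andP; split.
  apply: ge_inf; last by exists (thetas x y).
  by exists (lower_obj x y (thetas x y)) => _ [w Yw <-]; exact: tmin.
apply: lb_le_inf; first by exists (lower_obj x y (thetas x y)), (thetas x y).
by move=> _ [w Yw <-]; exact: tmin.
Qed.

Lemma vgamma_le x y w : X x -> Y w -> vgamma P gam (x, y) <= lower_obj x y w.
Proof.
by move=> Xx Yw; rewrite vgammaE//; have [_] := thetastar_min y Xx; apply.
Qed.

Lemma vgamma_le_phi x y : X x -> Y y -> vgamma P gam (x, y) <= phi (x, y).
Proof.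
move=> Xx Yy; apply: le_trans (vgamma_le y Xx Yy) _.
by rewrite /lower_obj subrr enorm0 expr0n/= mulr0 addr0.
Qed.

(** [thetastar] is Lipschitz: by strong convexity, the two minimality
    inequalities bound the distance of the minimizers by the variation of the
    objective, whose [x]-derivative is Lipschitz in [theta]. *)
Lemma thetastar_lipschitz x x' y y' : X x -> X x' ->
  enorm (thetas x' y' - thetas x y) <=
    enorm (y' - y) + gam * (Lfx c + Lg2 c) * enorm (x' - x).
Proof.
move=> Xx Xx'; set t := thetas x y; set t' := thetas x' y'.
have Yt : Y t by exact: thetastar_in.
have Yt' : Y t' by exact: thetastar_in.
have h1 := thetastar_variational y Xx Yt'.
have h2 := thetastar_variational y' Xx' Yt.
rewrite -/t in h1; rewrite -/t' in h2; clearbody t t'.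
have h3 : phi (x', t) - phi (x, t) - (phi (x', t') - phi (x, t')) <=
    (Lfx c + Lg2 c) * enorm (t' - t) * enorm (x' - x).
  apply: (@increment_diff_le _ _ X (X_convex hP) (fun u => phi (u, t))
    (fun u => phi (u, t'))) => // w Xw.
  - exact: phi_diff_x.
  - exact: phi_diff_x.
  - by rewrite (enorm_distC t' t); exact: gradx_phi_lip_y.
set d := enorm (t' - t).
have d0 : 0 <= d by exact: enorm_ge0.
have [dz|dnz] := eqVneq d 0.
  have [[_ _ Lf0 _] [_ Lg0]] := constants_ge0 hP.
  rewrite dz; apply: addr_ge0; first exact: enorm_ge0.
  apply: mulr_ge0; last exact: enorm_ge0.
  by apply: mulr_ge0; [exact: ltW|exact: addr_ge0].
have dp : 0 < d by rewrite lt0r dnz.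
have h4 : dot (y - t) (t' - t) + dot (y' - t') (t - t') =
    d ^+ 2 - dot (y' - y) (t' - t).
  by rewrite /d enorm_sqr !dotE (dotC t' t); ring.
have h5 := dot_le (y' - y) (t' - t); rewrite -/d in h5 h3.
have h6 : gam^-1 * (d ^+ 2 - dot (y' - y) (t' - t)) <=
    (Lfx c + Lg2 c) * d * enorm (x' - x).
  by rewrite -h4 mulrDr; lra.
rewrite ler_pdivrMl// in h6.
rewrite -(ler_pM2l dp) -expr2; lra.
Qed.

Section ErrorBound.

(* M times the residual bounds a subgradient of the proximal lower-level
   objective at the point produced by the step. *)
Let M := (a_eta a)^-1 + Lfy c + gam^-1.
Hypothesis eta0 : 0 < a_eta a.

(** A positive factor leaves the indicator function unchanged. *)
Lemma gtildeZ x (b : R) : 0 < b ->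
  (fun u => (b%:E * gtilde P x u)%E) =
  (fun u => ((b * g (x, u))%:E + indicator_fun R Y u)%E).
Proof.
move=> b0; apply/funext => u; rewrite /gtilde /indicator_fun.
by case: ifP => _; rewrite ?adde0 ?EFinM// addey// addey// gt0_muley// lte_fin.
Qed.

Lemma Prox_g x b v (u := Prox (fun w => (b%:E * gtilde P x w)%E) v) :
  X x -> 0 < b ->
  Y u /\ forall w, Y w -> g (x, u) + b^-1 * dot (v - u) (w - u) <= g (x, w).
Proof.
move=> Xx b0; rewrite /u gtildeZ//.
have [|||||Yp hp] := @Prox_indicator _ _ Y (fun w => b * g (x, w)) v.
- exact: Y_closed hP.
- exact: Y_convex hP.
- exact: Y0.
- by apply: convex_onZ; [exact: ltW|exact: g_convex_on].
- move=> y; apply: cvgM; first exact: cvg_cst.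
  exact: (within_section Xx (g_continuous hP)).
split => // w Yw; have := hp w Yw; set p := Prox _ _ => h1.
rewrite -(ler_pM2l b0) mulrDr mulrA mulfV ?gt_eqF// mul1r; exact: h1.
Qed.

(** Error bound after a proximal gradient step.  The step size [a_eta] is
    arbitrary: only the size of a subgradient at the new point matters. *)
Lemma prox_step_bound x y th (p := prox_step P a th x y)
    (t := thetas x y) (r := residual P a th x y) :
  X x -> Y th ->
  [/\ Y p, enorm (p - t) <= gam * M * r &
      lower_obj x y p - lower_obj x y t <= gam * M ^+ 2 * r ^+ 2].
Proof.
move=> Xx Yth.
have [Yp hp] : Y p /\ forall w, Y w -> g (x, p) + (a_eta a)^-1 *
    dot (th - a_eta a *: (grady f (x, th) + gam^-1 *: (th - y)) - p) (w - p)
    <= g (x, w).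
  exact: Prox_g.
have Yt : Y t by exact: thetastar_in.
have r0 : 0 <= r by exact: enorm_ge0.
have M0 : 0 <= M.
  have [[_ _ _ ?] _] := constants_ge0 hP.
  by rewrite /M !addr_ge0// invr_ge0 ltW.
set D := grady f (x, th) in hp *; set D' := grady f (x, p).
have hD : enorm (D' - D) <= Lfy c * r.
  rewrite /r /residual (enorm_distC th).
  exact: lipschitz_y (gradyf_lipschitz hP) Xx Yth Yp.
have hg := hp t Yt.
have hf := f_first_order Xx Yp Yt.
rewrite -/D' in hf.
have hsm := prox_gradient_gap eta0 gam0 hg hf hD.
rewrite -/M -/r in hsm; set d := enorm (p - t) in hsm *.
have {}hsm : lower_obj x y p - lower_obj x y t + (2 * gam)^-1 * d ^+ 2 <=
    M * r * d by exact: hsm.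
have hst := thetastar_strong_min y Xx Yp; rewrite -/t -/d in hst.
have d0 : 0 <= d by exact: enorm_ge0.
have gi0 : 0 < (2 * gam)^-1 by [].
have hd : d <= gam * M * r.
  have [->|dnz] := eqVneq d 0; first by rewrite !mulr_ge0// ltW.
  have dp : 0 < d by rewrite lt0r dnz.
  have : gam^-1 * d ^+ 2 <= M * r * d.
    have -> : gam^-1 = 2 * (2 * gam)^-1 by field; rewrite gt_eqF.
    by lra.
  by rewrite ler_pdivrMl// expr2 mulrA ler_pM2r// mulrA.
split => //.
have q0 : 0 <= (2 * gam)^-1 * d ^+ 2 by rewrite mulr_ge0 ?sqr_ge0 ?ltW.
apply: (@le_trans _ _ (M * r * d)); first by lra.
have := ler_wpM2l (mulr_ge0 M0 r0) hd.
by rewrite (_ : M * r * (gam * M * r) = gam * M ^+ 2 * r ^+ 2)//; ring.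
Qed.

(** Error bound before the step: the residual is the length of the step. *)
Lemma residual_bound x y th : X x -> Y th ->
  enorm (th - thetas x y) <= (1 + gam * M) * residual P a th x y.
Proof.
move=> Xx Yth; have [_ hp _] := prox_step_bound y Xx Yth.
apply: le_trans (enormB_le _ (prox_step P a th x y) _) _.
by rewrite mulrDl mul1r; apply: lerD.
Qed.

End ErrorBound.
End LowerLevel.

(** * Descent of the merit function along one iteration *)

Section StepDescent.
Context {R : realType} {n m : nat}.
Variables (P : bilevel R n m) (c : constants R) (a : agils_param R).
Hypothesis hP : standing P c.
Hypothesis Y0 : bY P !=set0.
Let X := bX P.
Let Y := bY P.
Let f := bf P.
Let g := bg P.
Let phi := bphi P.
Let gam := a_gam a.
Hypothesis gam0 : 0 < gam.
Local Notation thetas x y := (thetastar P gam (x, y)).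
Local Notation v x y := (vgamma P gam (x, y)).

Lemma sqr_enorm_conv (k : nat) (u w z : 'rV[R]_k) (s : R) :
  enorm (u + s *: (w - u) - z) ^+ 2 =
  (1 - s) * enorm (u - z) ^+ 2 + s * enorm (w - z) ^+ 2
    - s * (1 - s) * enorm (w - u) ^+ 2.
Proof.
by rewrite !enorm_sqr !dotE (dotC w u) (dotC z u) (dotC z w); ring.
Qed.

(** The two weak convexity assumptions, added and expanded along a segment. *)
Lemma phi_weakly_convex x x' th th' (s : R) :
  X x -> X x' -> Y th -> Y th' -> 0 <= s <= 1 ->
  phi (x + s *: (x' - x), th + s *: (th' - th)) <=
    (1 - s) * phi (x, th) + s * phi (x', th') +
    s * (1 - s) * ((rhof1 c + rhog1 c) / 2 * enorm (x' - x) ^+ 2 +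
      (rhof2 c + rhog2 c) / 2 * enorm (th' - th) ^+ 2).
Proof.
move=> Xx Xx' Yt Yt' s01.
have XY : bXY P (x, th) by [].
have XY' : bXY P (x', th') by [].
have := convex_function_on (f_weakly_convex hP) XY XY' s01.
have := convex_function_on (g_weakly_convex hP) XY XY' s01.
have -> : (x, th) + s *: ((x', th') - (x, th)) =
  (x + s *: (x' - x), th + s *: (th' - th)) by [].
rewrite /= /phi /bphi; set xs := x + _; set ts := th + _.
have -> : enorm xs ^+ 2 = (1 - s) * enorm x ^+ 2 + s * enorm x' ^+ 2
    - s * (1 - s) * enorm (x' - x) ^+ 2.
  by have := sqr_enorm_conv x x' 0 s; rewrite !subr0.
have -> : enorm ts ^+ 2 = (1 - s) * enorm th ^+ 2 + s * enorm th' ^+ 2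
    - s * (1 - s) * enorm (th' - th) ^+ 2.
  by have := sqr_enorm_conv th th' 0 s; rewrite !subr0.
by clearbody xs ts; lra.
Qed.

(** Weak convexity of the envelope in its first argument.  The point
    [(x, thetastar)] is joined to [(x', thetastar')]; along this segment the
    lower-level objective is weakly convex jointly, the concavity in
    [theta] being absorbed by the proximal term, and its initial slope is that of [phi] in
    [x] because [thetastar] is a minimizer. *)
Lemma vgamma_lower_x x x' y :
  (rhof2 c + rhog2 c) / 2 <= (2 * gam)^-1 -> X x -> X x' ->
  v x y + dot (gradx phi (x, thetas x y)) (x' - x)
    - (rhof1 c + rhog1 c) / 2 * enorm (x' - x) ^+ 2 <= v x' y.
Proof.
move=> rho2 Xx Xx'; rewrite !(vgammaE hP Y0 gam0)//.
have [Yt tmin] := thetastar_min hP Y0 gam0 y Xx.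
have Yt' := thetastar_in hP Y0 gam0 y Xx'.
set t := thetas x y in Yt tmin *; set t' := thetas x' y in Yt' *.
set G := gradx phi (x, t); set rho1 := rhof1 c + rhog1 c.
have [[_ _ Lf0 _] [Lg10 Lg20]] := constants_ge0 hP.
have rho10 : 0 <= rho1.
  by have [? _ ? _] := rho_ge0 hP; rewrite addr_ge0.
suff : dot G (x' - x) <= lower_obj P a x' y t' - lower_obj P a x y t
   + rho1 / 2 * enorm (x' - x) ^+ 2 by lra.
set dx2 := enorm (x' - x) ^+ 2.
pose C := (Lfx c + Lg2 c) * enorm (t' - t) * enorm (x' - x)
          + (Lfx c + Lg1 c) / 2 * dx2.
apply: (@ler_first_order _ _ _ C) => s /andP[s0 s1].
have s01 : 0 <= s <= 1 by rewrite ltW.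
pose xs := x + s *: (x' - x); pose ts := t + s *: (t' - t).
have Xxs : X xs by exact: convex_set_seg (X_convex hP) Xx Xx' s01.
have Yts : Y ts by exact: convex_set_seg (Y_convex hP) Yt Yt' s01.
have xsB : xs - x = s *: (x' - x) by rewrite /xs addrAC subrr add0r.
have tsB : ts - t = s *: (t' - t) by rewrite /ts addrAC subrr add0r.
have h1 := phi_weakly_convex Xx Xx' Yt Yt' s01.
rewrite -/xs -/ts -/dx2 -/rho1 in h1.
have h2 : enorm (ts - y) ^+ 2 = _ := sqr_enorm_conv t t' y s.
have h3 : phi (x, ts) + s * dot (gradx phi (x, ts)) (x' - x)
    - (Lfx c + Lg1 c) / 2 * (s ^+ 2 * dx2) <= phi (xs, ts).
  have := @descent _ _ X (X_convex hP) (fun u => phi (u, ts))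
    (Lfx c + Lg1 c) x xs (fun w Xw => phi_diff_x hP Xw Yts)
    (fun w Xw => gradx_phi_lip_x hP Xx Xw Yts) Xx Xxs.
  rewrite xsB dotZr enormZ (gtr0_norm s0) exprMn.
  by rewrite ler_norml => /andP[lo _]; move: lo; rewrite -/dx2 /gradx /=; lra.
have h4 : dot G (x' - x)
    - (Lfx c + Lg2 c) * (s * enorm (t' - t)) * enorm (x' - x) <=
    dot (gradx phi (x, ts)) (x' - x).
  have := dot_ge (gradx phi (x, ts) - G) (x' - x).
  rewrite dotDl dotNl => h.
  have := gradx_phi_lip_y hP Xx Yt Yts.
  rewrite tsB enormZ (gtr0_norm s0) -/G => hG.
  by have := ler_wpM2r (enorm_ge0 (x' - x)) hG; lra.
have h5 := tmin _ Yts.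
have q0 : 0 <= enorm (t' - t) ^+ 2 by exact: sqr_ge0.
have dx20 : 0 <= dx2 by exact: sqr_ge0.
have ss : 0 <= s * (1 - s) by rewrite mulr_ge0 ?subr_ge0// ltW.
have h6 := ler_wpM2r (mulr_ge0 ss q0) rho2.
have h7 : s * (1 - s) * (rho1 / 2 * dx2) <= s * (rho1 / 2 * dx2).
  apply: ler_wpM2r; first by rewrite mulr_ge0// divr_ge0.
  by rewrite ler_piMr ?gerBl// ltW.
have h8 := ler_wpM2l (ltW s0) h4.
move: h1 h5; rewrite /lower_obj -/gam -/phi h2 /C => h1 h5.
clearbody xs ts t t' dx2 G rho1.
move: (phi _) (phi _) (phi _) (phi _) h1 h3 h5 => p1 p2 p3 p4.
lra.
Qed.

(** The envelope is convex in its second argument, so that it lies above its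
    tangents. *)
Lemma vgamma_lower_y x y y' : X x -> Y y ->
  v x y + gam^-1 * dot (y - thetas x y) (y' - y) <= v x y'.
Proof.
move=> Xx Yy; rewrite !(vgammaE hP Y0 gam0)//.
have Yt' := thetastar_in hP Y0 gam0 y' Xx.
have := thetastar_variational hP Y0 gam0 y Xx Yt'.
rewrite /lower_obj -/gam -/phi.
set t := thetas x y; set t' := thetas x y' in Yt' *; clearbody t t'.
move: (phi _) (phi _) => p1 p2 h1.
have E : (2 * gam)^-1 * (enorm (t' - y') ^+ 2 - enorm (t - y) ^+ 2) +
   gam^-1 * dot (y - t) (t' - t) - gam^-1 * dot (y - t) (y' - y) =
   (2 * gam)^-1 * enorm (t' - y' + (y - t)) ^+ 2.
  rewrite !enorm_sqr !dotE (dotC y' t') (dotC y t') (dotC y y') (dotC t t')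
    (dotC t y') (dotC t y).
  by field; rewrite gt_eqF.
have : 0 <= (2 * gam)^-1 * enorm (t' - y' + (y - t)) ^+ 2.
  by rewrite mulr_ge0 ?sqr_ge0// invr_ge0 mulr_ge0// ltW.
by rewrite -E; lra.
Qed.

Lemma step_size_inv (b L k : R) : 0 < b -> 0 <= L -> 0 < k ->
  b <= 2 / (L + k) -> (L + k) / 2 <= b^-1.
Proof.
move=> b0 L0 k0; have Lk : 0 < L + k by rewrite ltr_wpDl.
by rewrite -(ler_pV2 _ _) ?inE ?unitf_gt0 ?gt_eqF ?divr_gt0// invf_div.
Qed.

(** The merit function of the descent argument: the penalized objective with
    the exact envelope. *)
Definition merit (p : R) (x : 'rV[R]_n) (y : 'rV[R]_m) : R :=
  p^-1 * bF P (x, y) + phi (x, y) - v x y.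

Lemma young (k e d : R) : 0 < k -> e * d <= k / 4 * d ^+ 2 + k^-1 * e ^+ 2.
Proof.
move=> k0; rewrite -(ler_pM2l k0) mulrDr mulrA (mulrA k k^-1).
rewrite mulfV ?gt_eqF// mul1r.
by have := sqr_ge0 (k * d / 2 - e); lra.
Qed.

(** One proximal gradient step in [y] from [yt], with an approximation [tht]
    of the lower-level solution: the second-order terms are absorbed by the
    step size, and the inexactness by half of the remaining decrease. *)
Lemma y_step_descent x yt tht (p b k : R)
    (d := p^-1 *: grady (bF P) (x, yt) + grady f (x, yt)
          - gam^-1 *: (yt - tht))
    (y1 := Prox (fun u => (b%:E * gtilde P x u)%E) (yt - b *: d)) :
  X x -> Y yt -> 0 < p -> 0 < b -> 0 < k -> b <= 2 / (Lpsiy c p + k) ->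
  Y y1 /\ merit p x y1 <= merit p x yt - k / 4 * enorm (y1 - yt) ^+ 2
    + k^-1 * (gam^-1 * enorm (tht - thetas x yt)) ^+ 2.
Proof.
move=> Xx Yyt p0 b0 k0 bk.
have [Yy1 hprox] := Prox_g hP Y0 (yt - b *: d) Xx b0.
rewrite -/y1 in Yy1 hprox; split => //.
have {}hprox := hprox _ Yyt.
have pi0 : 0 < p^-1 by rewrite invr_gt0.
have [[_ LF0 _ Lf0] _] := constants_ge0 hP.
have L0 : 0 <= Lpsiy c p by rewrite addr_ge0// divr_ge0// ltW.
have hb := step_size_inv b0 L0 k0 bk.
have hF := @descent _ _ Y (Y_convex hP) (fun u => bF P (x, u)) (LFy c) yt y1
  (fun w Yw => differentiable_pair_r ((F_C1 hP).1 (x, w) (conj Xx Yw)))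
  (fun w Yw => lipschitz_y (gradyF_lipschitz hP) Xx Yyt Yw) Yyt Yy1.
have hf := @descent _ _ Y (Y_convex hP) (fun u => f (x, u)) (Lfy c) yt y1
  (fun w Yw => f_diff_y hP Xx Yw)
  (fun w Yw => lipschitz_y (gradyf_lipschitz hP) Xx Yyt Yw) Yyt Yy1.
have hv := @vgamma_lower_y x yt y1 Xx Yyt.
move: hF hf; rewrite !ler_norml => /andP[_ hF] /andP[_ hf].
set DF := grad (fun u => bF P (x, u)) yt in hF.
set Df := grad (fun u => f (x, u)) yt in hf.
have dE : d = p^-1 *: DF + Df - gam^-1 *: (yt - tht) by [].
rewrite {}dE in hprox; clearbody y1 DF Df; clear d.
set t := thetas x yt in hv *; clearbody t.
set D := y1 - yt in hF hf hv *.
have hin : - (gam^-1 * enorm (tht - t) * enorm D) <= gam^-1 * dot (tht - t) D.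
  rewrite -mulrA -mulrN; apply: ler_wpM2l; first by rewrite invr_ge0 ltW.
  exact: dot_ge.
have E1 : b^-1 * dot (yt - b *: (p^-1 *: DF + Df - gam^-1 *: (yt - tht)) - y1)
     (yt - y1) = b^-1 * enorm D ^+ 2 + p^-1 * dot DF D + dot Df D
     - gam^-1 * dot (yt - t) D + gam^-1 * dot (tht - t) D.
  rewrite -(opprB y1 yt) -/D (_ : yt - _ - y1 = - D -
    b *: (p^-1 *: DF + Df - gam^-1 *: (yt - tht))); last first.
    by rewrite /D opprB addrAC.
  rewrite enorm_sqr; clearbody D; rewrite !dotE; field; rewrite !gt_eqF//.
rewrite E1 in hprox.
have hy := young (gam^-1 * enorm (tht - t)) (enorm D) k0.
have hF' := ler_wpM2l (ltW pi0) hF.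
have hb' := ler_wpM2r (sqr_ge0 (enorm D)) hb.
rewrite /merit /Lpsiy in hb' *.
have -> : phi (x, y1) = f (x, y1) + bg P (x, y1) by [].
have -> : phi (x, yt) = f (x, yt) + bg P (x, yt) by [].
clearbody D.
move: (enorm D ^+ 2) hin hy hf hF' hb' hprox => D2.
move: (gam^-1 * dot (yt - t) D) (gam^-1 * dot (tht - t) D) hv => g1 g2.
move: (gam^-1 * enorm (tht - t)) (enorm D) => e1 e2.
move: (b^-1) (k^-1) => bi ki.
move: (f _) (f _) (bg P _) (bg P _) (v _ _) (v _ _) (dot Df D) (dot DF D) => *.
lra.
Qed.

(** One projected gradient step in [x], with an approximation [thh] of the
    lower-level solution. *)
Lemma x_step_descent x y1 thh (p al k : R)
    (d := p^-1 *: gradx (bF P) (x, y1) + gradx phi (x, y1)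
          - gradx f (x, thh) - gradx g (x, thh))
    (x1 := Proj X (x - al *: d)) :
  (rhof2 c + rhog2 c) / 2 <= (2 * gam)^-1 ->
  X x -> Y y1 -> Y thh -> 0 < p -> 0 < al -> 0 < k ->
  al <= 2 / (Lpsix c p + k) ->
  X x1 /\ merit p x1 y1 <= merit p x y1 - k / 4 * enorm (x1 - x) ^+ 2
    + k^-1 * ((Lfx c + Lg2 c) * enorm (thh - thetas x y1)) ^+ 2.
Proof.
move=> rho2 Xx Yy1 Yth p0 al0 k0 alk.
have [Xx1 hproj] := Proj_variational (x - al *: d) (X_closed hP) (X_convex hP)
  (ex_intro _ x Xx).
rewrite -/x1 in Xx1 hproj; split => //.
have {}hproj := hproj _ Xx.
have pi0 : 0 < p^-1 by rewrite invr_gt0.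
have [[LF0 _ Lf0 _] [Lg10 Lg20]] := constants_ge0 hP.
have L0 : 0 <= Lpsix c p.
  have [? _ ? _] := rho_ge0 hP.
  by rewrite !addr_ge0// divr_ge0// ltW.
have hal := step_size_inv al0 L0 k0 alk.
have hF := @descent _ _ X (X_convex hP) (fun u => bF P (u, y1)) (LFx c) x x1
  (fun w Xw => differentiable_pair_l ((F_C1 hP).1 (w, y1) (conj Xw Yy1)))
  (fun w Xw => lipschitz_x (gradxF_lipschitz hP) Xx Xw Yy1) Xx Xx1.
have hphi := @descent _ _ X (X_convex hP) (fun u => phi (u, y1))
  (Lfx c + Lg1 c) x x1 (fun w Xw => phi_diff_x hP Xw Yy1)
  (fun w Xw => gradx_phi_lip_x hP Xx Xw Yy1) Xx Xx1.
have hv := vgamma_lower_x y1 rho2 Xx Xx1.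
have Yt := thetastar_in hP Y0 gam0 y1 Xx.
have hG := gradx_phi_lip_y hP Xx Yt Yth.
move: hF hphi; rewrite !ler_norml => /andP[_ hF] /andP[_ hphi].
set DF := grad (fun u => bF P (u, y1)) x in hF.
set Dp := grad (fun u => phi (u, y1)) x in hphi.
set G := gradx phi (x, thetas x y1) in hv hG *.
rewrite (gradx_phi hP)// in hG; set G' := _ + gradx g (x, thh) in hG.
have dE : d = p^-1 *: DF + Dp - G' by rewrite /d /G' opprD addrA.
rewrite {}dE in hproj; clearbody x1 DF Dp G G'; clear d.
set t := thetas x y1 in hv hG *; clearbody t.
set D := x1 - x in hF hphi hv *.
have hin : dot (G' - G) D <= (Lfx c + Lg2 c) * enorm (thh - t) * enorm D.
  apply: le_trans (dot_le _ _) _.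
  by apply: ler_wpM2r; first exact: enorm_ge0.
have E1 : dot (x - al *: (p^-1 *: DF + Dp - G') - x1) (x - x1) =
    al * (al^-1 * enorm D ^+ 2 + p^-1 * dot DF D + dot Dp D
     - dot G D - dot (G' - G) D).
  rewrite -(opprB x1 x) -/D (_ : x - _ - x1 = - D -
    al *: (p^-1 *: DF + Dp - G')); last by rewrite /D opprB addrAC.
  rewrite enorm_sqr; clearbody D; rewrite !dotE; field; rewrite !gt_eqF//.
rewrite {}E1 pmulr_rle0// in hproj.
have hy := young ((Lfx c + Lg2 c) * enorm (thh - t)) (enorm D) k0.
have hF' := ler_wpM2l (ltW pi0) hF.
have hal' := ler_wpM2r (sqr_ge0 (enorm D)) hal.
rewrite /merit /Lpsix in hal' *.
clearbody D.
move: (enorm D ^+ 2) hin hy hphi hF' hal' hv hproj => D2.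
move: ((Lfx c + Lg2 c) * enorm (thh - t)) (enorm D) => e1 e2.
move: (al^-1) (k^-1) (dot (G' - G) D) => ai ki e3.
move: (phi _) (phi _) (v _ _) (v _ _) (dot Dp D) (dot DF D) (dot G D) => *.
lra.
Qed.

(** The acceptance test compares inexact values of the merit function.  They
    are at most the exact ones, and at the corrected point the difference is
    quadratic in the residual. *)
Lemma correction_descent x1 y1 th1 yc thh (p : R)
    (M := (a_eta a)^-1 + Lfy c + gam^-1)
    (thc := prox_step P a thh x1 yc) :
  X x1 -> Y y1 -> Y th1 -> Y yc -> Y thh -> 0 < a_eta a ->
  p^-1 * bF P (x1, yc) + gap P a x1 yc thc <=
    p^-1 * bF P (x1, y1) + gap P a x1 y1 th1 ->
  merit p x1 yc <= merit p x1 y1 + gam * M ^+ 2 * residual P a thh x1 yc ^+ 2.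
Proof.
move=> Xx1 Yy1 Yth1 Yyc Ythh eta0 hle.
have [_ _ hc] := prox_step_bound hP Y0 gam0 eta0 yc Xx1 Ythh.
rewrite -/M -/thc -(vgammaE hP Y0 gam0)// in hc.
have hv := vgamma_le hP Y0 gam0 y1 Xx1 Yth1.
rewrite /gap in hle; rewrite /lower_obj in hc hv; rewrite /merit.
move: hle hc hv; rewrite -/gam -/phi; lra.
Qed.

End StepDescent.

(** * Vanishing of the steps *)

(** The partial sums of [u] are bounded above. *)
Definition bounded_sums {R : realType} (u : nat -> R) :=
  exists B, forall N, \sum_(0 <= k < N) u k <= B.

Section BoundedSums.
Context {R : realType}.
Implicit Types u v : nat -> R.

Lemma bounded_sumsS u : bounded_sums (fun k => u k.+1) -> bounded_sums u.
Proof.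
move=> [B hB]; exists (Num.max 0 (u 0%N + B)) => -[|N].
  by rewrite big_nil le_max lexx.
by rewrite big_nat_recl// le_max lerD2l hB orbT.
Qed.

Lemma bounded_sums_shift u K :
  bounded_sums (fun k => u (k + K)%N) -> bounded_sums u.
Proof.
elim: K u => [|K ih] u; first by move=> [B h]; exists B => N; have := h N;
  under eq_bigr do rewrite addn0.
move=> h; apply: bounded_sumsS; apply: (ih (fun k => u k.+1)).
by move: h => [B h]; exists B => N; have := h N; under eq_bigr do rewrite addnS.
Qed.

Lemma bounded_sums_drop u K : (forall k, 0 <= u k) ->
  bounded_sums u -> bounded_sums (fun k => u (k + K)%N).
Proof.
move=> u0 [B hB]; exists B => N; apply: le_trans (hB (N + K)%N).
have E : \sum_(K <= k < N + K) u k = \sum_(0 <= k < N) u (k + K)%N.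
  by rewrite -{1}[K]add0n big_addn addnK.
by rewrite (big_cat_nat (leq0n K) (leq_addl N K))/= E lerDr sumr_ge0.
Qed.

Lemma bounded_sums_le u v : (forall k, u k <= v k) ->
  bounded_sums v -> bounded_sums u.
Proof.
by move=> uv [B hB]; exists B => N; apply: le_trans (hB N); exact: ler_sum.
Qed.

Lemma bounded_sums_lin u v (a b : R) : 0 <= a -> 0 <= b ->
  bounded_sums u -> bounded_sums v -> bounded_sums (fun k => a * u k + b * v k).
Proof.
move=> a0 b0 [B hB] [C hC]; exists (a * B + b * C) => N.
by rewrite big_split/= -!mulr_sumr lerD// ler_wpM2l.
Qed.

Lemma bounded_sums_series u : (forall k, 0 <= u k) ->
  cvgn (series u) -> bounded_sums u.
Proof.
move=> u0 cu; exists (limn (series u)) => N.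
by apply: nondecreasing_cvgn_le cu N; exact: nondecreasing_series.
Qed.

Lemma bounded_sums_cvg0 u : (forall k, 0 <= u k) -> bounded_sums u ->
  u k @[k --> \oo] --> (0 : R).
Proof.
move=> u0 [B hB]; apply: cvg_series_cvg_0; apply: nondecreasing_is_cvgn.
  exact: nondecreasing_series.
by exists B => _ [N _ <-]; exact: hB.
Qed.

(** Contraction up to a perturbation with bounded sums. *)
Lemma bounded_sums_contraction u v : (forall k, 0 <= u k) ->
  (forall k, 0 <= v k) ->
  (forall k, u k.+1 <= v k.+1 + u k / 4) -> bounded_sums v -> bounded_sums u.
Proof.
move=> u0 v0 uv [B hB]; exists (4 / 3 * (u 0%N + B)) => -[|N].
  rewrite big_nil; have := hB 0%N; rewrite big_nil => B0.
  by rewrite mulr_ge0 ?addr_ge0.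
have h1 : \sum_(0 <= k < N) u k.+1 <=
    \sum_(0 <= k < N) v k.+1 + (\sum_(0 <= k < N) u k) / 4.
  by rewrite mulr_suml -big_split/=; apply: ler_sum.
have h2 : \sum_(0 <= k < N) v k.+1 <= B.
  by apply: le_trans (hB N.+1); rewrite big_nat_recl// lerDr.
have h3 : \sum_(0 <= k < N) u k <= \sum_(0 <= k < N.+1) u k.
  by rewrite [leRHS]big_nat_recr//= lerDl.
move: h3; rewrite [\sum_(0 <= k < N.+1) u k]big_nat_recl//; lra.
Qed.

(** The decrements of a sequence that is bounded below have bounded sums, up to
    a perturbation with bounded sums. *)
Lemma bounded_sums_descent (V D e : nat -> R) (L : R) :
  (forall k, L <= V k) ->
  (forall k, V k.+1 + D k <= V k + e k) -> bounded_sums e -> bounded_sums D.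
Proof.
move=> VL VD [B hB]; exists (V 0%N - L + B) => N.
have : V N + \sum_(0 <= k < N) D k <= V 0%N + \sum_(0 <= k < N) e k.
  elim: N => [|N ih]; first by rewrite !big_nil !addr0.
  by rewrite !big_nat_recr//=; have := VD N; lra.
by have := VL N; have := hB N; lra.
Qed.

End BoundedSums.

(** Here [V0], [V1], [V2] and [V3] are the merit values at the start, after the
    [y]-step, after the [x]-step and after the possible correction. *)
Lemma descent_combination {R : realType}
  (V3 V2 V1 V0 dx dy k ca cb ea eb Ca Cb Cc t t1 : R) :
  0 <= Ca -> 0 <= Cb -> 0 <= Cc -> 0 <= t -> 0 <= t1 ->
  k * dx <= ca * dx -> k * dy <= cb * dy ->
  V2 <= V1 - ca / 4 * dx + ea -> V1 <= V0 - cb / 4 * dy + eb ->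
  ea <= Ca * t -> eb <= Cb * t -> V3 <= V2 + Cc * t1 ->
  V3 + k / 4 * (dx + dy) <= V0 + ((Ca + Cb + Cc) * t + (Ca + Cb + Cc) * t1).
Proof.
move=> Ca0 Cb0 Cc0 t0 t10 ? ? ? ? ? ? ?.
have A1 := mulr_ge0 Cc0 t0; have A2 := mulr_ge0 (addr_ge0 Ca0 Cb0) t10.
lra.
Qed.

Section Algorithm.
Context {R : realType} {n m : nat}.
Variables (P : bilevel R n m) (c : constants R) (a : agils_param R)
  (q : agils_seq R n m) (alow blow calpha cbeta : R).
Hypothesis hP : standing P c.
Hypothesis ha : agils_param_ok a.
Hypothesis hgam : rhof2 c + rhog2 c = 0 \/ a_gam a < 1 / (rhof2 c + rhog2 c).
Hypothesis hpos : [/\ 0 < alow, 0 < blow, 0 < calpha & 0 < cbeta].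
Hypothesis halpha : forall k,
  alow <= a_alpha a k <= 2 / (Lpsix c (s_p q k) + calpha).
Hypothesis hbeta : forall k,
  blow <= a_beta a k <= 2 / (Lpsiy c (s_p q k) + cbeta).
Hypothesis hq : agils P a q.
Hypothesis hp : exists M : R, forall k, `|s_p q k| <= M.

Let X := bX P.
Let Y := bY P.
Let gam := a_gam a.
Local Notation thetas x y := (thetastar P gam (x, y)).

Lemma Y_neq0 : bY P !=set0.
Proof. by have [[[_ ? _ _] _] _] := hq; exists (s_y q 0%N). Qed.
Let Y0 := Y_neq0.

Lemma gam_gt0 : 0 < a_gam a. Proof. by have [[]] := ha. Qed.
Let gam0 := gam_gt0.

Lemma eta_gt0 : 0 < a_eta a. Proof. by have [[]] := ha. Qed.
Let eta0 := eta_gt0.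

(** The bound on [gam]: the proximal term dominates the concavity of [phi] in
    its second argument. *)
Lemma rho_gam : (rhof2 c + rhog2 c) / 2 <= (2 * gam)^-1.
Proof.
have g2 : 0 < 2 * gam by rewrite mulr_gt0.
have [->|glt] := hgam; first by rewrite mul0r invr_ge0 ltW.
have [_ r1 _ r2] := rho_ge0 hP.
have r0 : 0 < rhof2 c + rhog2 c.
  rewrite lt0r addr_ge0// andbT; apply/eqP => r0.
  by move: glt; rewrite r0 invr0 mulr0 => /(lt_trans gam0); rewrite ltxx.
rewrite ltr_pdivlMr// in glt.
rewrite -[(2 * gam)^-1]mul1r ler_pdivlMr//; move: glt; rewrite -/gam; lra.
Qed.

(** The tolerance prescribed for the inexact lower-level solutions.  With the
    convention that index -1 repeats index 0, it serves for theta^(k + 1/2) and,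
    at [k.+1], for theta^(k + 1) and for the correction. *)
Definition tol (k : nat) : R :=
  Num.max (a_s a k)
    (a_tau a k * residual P a (s_th q k.-1) (s_x q k.-1) (s_y q k.-1)).

(** The two outcomes of an iteration that keep the penalty parameter: a move
    that is large with respect to the constraint residual capped at the inverse
    penalty parameter, and an accepted correction.  In [corrected], the candidate pair is expressed through the
    next iterate, which it becomes. *)
Definition moved (k : nat) : Prop :=
  a_cp a * Num.min (s_p q k)^-1 (tres P a q k) <= Delta q k /\
  plain_update q k (s_p q k).

Definition corrected (k : nat) : Prop :=
  let x1 := s_x q k.+1 in
  exists thh,
    [/\ Y (s_yt q k.+1),
        enorm (s_yt q k.+1 - Prox (gtilde P x1)
           (s_yt q k.+1 - grady (bf P) (x1, s_yt q k.+1)))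
          <= a_cyt a / s_p q k * Delta q k,
        Y thh /\ residual P a thh x1 (s_yt q k.+1) <= tol k.+1,
        s_tht q k.+1 = prox_step P a thh x1 (s_yt q k.+1) &
        (s_p q k)^-1 * bF P (x1, s_yt q k.+1) +
            gap P a x1 (s_yt q k.+1) (s_tht q k.+1) <=
        (s_p q k)^-1 * bF P (x1, s_y q k.+1) +
            gap P a x1 (s_y q k.+1) (s_th q k.+1) /\
        s_p q k.+1 = s_p q k].

Lemma step_outcome k :
  [\/ moved k, plain_update q k (s_p q k + a_rho a) | corrected k].
Proof.
have [_ _ _ _ [h1 h2 h3]] := hq.2 k.
set th := a_cp a * _ in h1 h2 h3.
have [tD|Dt] := leP th (Delta q k).
  by apply: Or31; split => //; exact: h1.
have [dl|dg] := leP (enorm (s_y q k.+1 - s_th q k.+1))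
  (a_cy a * a_gam a / s_p q k).
  by apply: Or32; exact: h2.
have [yc [thh []]] := h3 Dt dg.
case: ifPn => [hle Yyc hyc Ythh hth [eyt etht ep]|].
  by apply: Or33; exists thh; rewrite etht eyt.
by move=> _ _ _ _ _ h; apply: Or32.
Qed.

Lemma iterates_in k :
  [/\ X (s_x q k), Y (s_y q k), Y (s_yt q k) & Y (s_th q k)] /\ 0 < s_p q k.
Proof.
have [_ [_ [[p00 rho0 _ _ _] _]]] := ha.
elim: k => [|k [[Xx Yy Yyt Yth] pk0]].
  have [[? ? ? ?] [eth ep]] := hq.1; split; last by rewrite ep.
  by split => //; rewrite eth.
have [ey [Yh _] ex [Yth1 _] _] := hq.2 k.
have [_ bk0] := (ha.2.1 k).
have Yy1 : Y (s_y q k.+1).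
  by rewrite ey; exact: (Prox_g hP Y0 _ Xx bk0).1.
have Xx1 : X (s_x q k.+1).
  rewrite ex; apply: (Proj_variational _ (X_closed hP) (X_convex hP) _).1.
  by exists (s_x q k).
have [[_ [-> -> _]]|[-> -> _]|[thh [Yc _ _ _ [_ ->]]]] := step_outcome k.
- by [].
- by rewrite addr_gt0.
- by [].
Qed.

(** Infinitely many increases by [a_rho] would contradict boundedness. *)
Lemma penalty_eventually_constant :
  exists K, forall k, (K <= k)%N -> s_p q k = s_p q K /\
    (moved k \/ corrected k).
Proof.
have [_ [_ [[_ rho0 _ _ _] _]]] := ha.
have pmono k : s_p q k <= s_p q k.+1.
  have [[_ [-> _ _]]|[-> _ _]|[? [_ _ _ _ [_ ->]]]] := step_outcome k => //.
  by rewrite lerDl ltW.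
have pmono2 i j : (i <= j)%N -> s_p q i <= s_p q j.
  move=> ij; apply: (@homo_leq _ _ (fun u v => u <= v)) ij => //.
  exact: le_trans.
suff [K hK] : exists K, forall k, (K <= k)%N -> s_p q k.+1 != s_p q k + a_rho a.
  have out k : (K <= k)%N -> moved k \/ corrected k.
    move=> Kk; have [|[h _ _]|] := step_outcome k; [by left| |by right].
    by have := hK k Kk; rewrite h eqxx.
  exists K => k Kk; split; last exact: out.
  elim: k Kk => [|k ih]; first by rewrite leqn0 => /eqP ->.
  rewrite leq_eqVlt => /orP[/eqP <-//|]; rewrite ltnS => Kk.
  by rewrite -(ih Kk); have [[_ []]|[? [_ _ _ _ [_ ->]]]] := out k Kk.
apply: contrapT => hno.
have inc K : exists2 k, (K <= k)%N & s_p q k.+1 = s_p q k + a_rho a.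
  apply: contrapT => h; apply: hno; exists K => k Kk; apply/eqP => e.
  by apply: h; exists k.
have big N : exists k, s_p q 0%N + a_rho a *+ N <= s_p q k.
  elim: N => [|N [k hk]]; first by exists 0%N; rewrite mulr0n addr0.
  have [j kj ej] := inc k; exists j.+1; rewrite ej mulrSr addrA lerD2r.
  by apply: le_trans hk _; exact: pmono2.
have [M hM] := hp.
pose N := Num.bound `|(M + 1 - s_p q 0%N) / a_rho a|.
have [k hk] := big N.
have := le_trans hk (le_trans (ler_norm _) (hM k)).
have : M + 1 - s_p q 0%N <= a_rho a *+ N.
  rewrite -mulr_natl -ler_pdivrMr//; apply: le_trans (ler_norm _) _.
  by apply: ltW; exact: archi_boundP.
lra.
Qed.

Lemma residual_le_tol k :
  residual P a (s_th q k.+1) (s_x q k.+1) (s_y q k.+1) <= tol k.+1.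
Proof. by have [_ _ _ []] := hq.2 k. Qed.

Lemma tol_ge0 k : 0 <= tol k.
Proof. by have [_ [_ [_ [s0 _]]]] := ha; rewrite le_max s0. Qed.

Lemma tau_eventually_small : exists K, forall k, (K <= k)%N ->
  0 <= a_tau a k <= 2^-1.
Proof.
have [_ [_ [_ [_ [_ [t0 p0]]]]]] := ha.
(* Beyond B the power (k + 1) ^ ptau is at least 2 tau0. *)
pose B := (2 * a_tau0 a) `^ (a_ptau a)^-1.
exists (Num.bound B) => k Kk.
have Bk : B <= k.+1%:R.
  apply: (@le_trans _ _ (Num.bound B)%:R); last by rewrite ler_nat leqW.
  by apply: ltW; apply: archi_boundP; exact: powR_ge0.
have : B `^ a_ptau a <= k.+1%:R `^ a_ptau a.
  by apply: ge0_ler_powR => //; rewrite ?nnegrE ?powR_ge0// ltW.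
have t20 : 0 <= 2 * a_tau0 a by rewrite mulr_ge0// ltW.
rewrite -powRrM mulVf ?gt_eqF// powRr1// => hB.
have k0 : 0 < k.+1%:R `^ a_ptau a by rewrite powR_gt0.
apply/andP; split; first by rewrite /a_tau divr_ge0 ?powR_ge0// ltW.
by rewrite /a_tau ler_pdivrMr//; lra.
Qed.

(** Each residual is at most the tolerance of the same index, so that the
    tolerances contract up to [a_s] once [a_tau] is at most one half. *)
Lemma tol_sqr_sums : bounded_sums (fun k => tol k ^+ 2).
Proof.
have [K hK] := tau_eventually_small.
have [_ [_ [_ [s0 [scvg _]]]]] := ha.
apply: (@bounded_sums_shift _ _ K.+1).
apply: (@bounded_sums_contraction _ _ (fun k => a_s a (k + K.+1)%N ^+ 2)).
- by move=> k; exact: sqr_ge0.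
- by move=> k; exact: sqr_ge0.
- move=> k; rewrite addSn addnS; set j := (k + K)%N.
  have /andP[t0 t1] : 0 <= a_tau a j.+2 <= 2^-1.
    by apply: hK; rewrite !leqW// leq_addl.
  have r1 := residual_le_tol j; have r0 := tol_ge0 j.+1.
  have G0 : 0 <= residual P a (s_th q j.+1) (s_x q j.+1) (s_y q j.+1).
    exact: enorm_ge0.
  rewrite {1}/tol /=; set G := residual _ _ _ _ _ in r1 G0 *.
  have tG : a_tau a j.+2 * G <= tol j.+1 / 2.
    apply: (@le_trans _ _ (2^-1 * G)); first exact: ler_wpM2r.
    by rewrite mulrC ler_pM2r// invr_gt0.
  have tG0 : 0 <= a_tau a j.+2 * G by exact: mulr_ge0.
  have s20 := sqr_ge0 (a_s a j.+2); have r20 := sqr_ge0 (tol j.+1).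
  have [_|_] := leP (a_s a j.+2) (a_tau a j.+2 * G); last by lra.
  have := ler_pM tG0 tG0 tG tG; rewrite -!expr2 expr_div_n; lra.
- apply: (@bounded_sums_drop _ (fun k => a_s a k ^+ 2)) => [k|].
    exact: sqr_ge0.
  by apply: bounded_sums_series scvg => k; exact: sqr_ge0.
Qed.

Let M := (a_eta a)^-1 + Lfy c + gam^-1.

Lemma M_ge0 : 0 <= M.
Proof.
have [[_ _ _ L0] _] := constants_ge0 hP.
by rewrite !addr_ge0// invr_ge0 ltW.
Qed.

Lemma gM_ge0 : 0 <= gam * M.
Proof. by rewrite mulr_ge0 ?M_ge0// ltW. Qed.

(** The error constant relating a residual to the distance to the exact
    lower-level solution. *)
Definition Cerr : R := 1 + gam * M.

Lemma Cerr_ge0 : 0 <= Cerr.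
Proof. by rewrite addr_ge0// gM_ge0. Qed.

(** Both outcomes leave a pair [(s_yt, s_tht)] whose second component is close
    to the exact lower-level solution for the first. *)
Lemma tht_error k : moved k \/ corrected k ->
  enorm (s_tht q k.+1 - thetas (s_x q k.+1) (s_yt q k.+1)) <= Cerr * tol k.+1.
Proof.
have [[Xx _ _ Yth] _] := iterates_in k.+1.
case=> [[_ [_ -> ->]]|[thh [Yyt _ [Ythh hth] -> _]]].
  apply: le_trans (residual_bound hP Y0 gam0 eta0 _ Xx Yth) _.
  by apply: ler_wpM2l; [exact: Cerr_ge0|exact: residual_le_tol].
have [_ hb _] := prox_step_bound hP Y0 gam0 eta0 (s_yt q k.+1) Xx Ythh.
apply: le_trans hb _; rewrite -/M -/gam.
apply: (@le_trans _ _ (gam * M * tol k.+1)).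
  by apply: ler_wpM2l => //; exact: gM_ge0.
by apply: ler_wpM2r; [exact: tol_ge0|rewrite lerDr].
Qed.

Lemma thh_error k :
  enorm (s_thh q k - thetas (s_x q k) (s_y q k.+1)) <= Cerr * tol k.
Proof.
have [[Xx _ _ _] _] := iterates_in k; have [_ [Yth hth] _ _ _] := hq.2 k.
apply: le_trans (residual_bound hP Y0 gam0 eta0 _ Xx Yth) _.
by apply: ler_wpM2l; first exact: Cerr_ge0.
Qed.

Lemma Delta_sqr k : Delta q k ^+ 2 =
  enorm (s_x q k.+1 - s_x q k) ^+ 2 + enorm (s_y q k.+1 - s_yt q k) ^+ 2.
Proof. by rewrite /Delta pnorm_sqr. Qed.

(** The merit function decreases by a multiple of the squared step, up to a
    summable error, as soon as the penalty parameter is constant.  The bound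
    is strict in [K < k] because the error on [s_tht q k] depends on the
    outcome of iteration [k.-1]. *)
Lemma merit_descent :
  exists K Ce kap, 0 <= Ce /\ 0 < kap /\ forall k, (K < k)%N ->
    merit P a (s_p q K) (s_x q k.+1) (s_yt q k.+1) + kap * Delta q k ^+ 2 <=
    merit P a (s_p q K) (s_x q k) (s_yt q k) +
      (Ce * tol k ^+ 2 + Ce * tol k.+1 ^+ 2).
Proof.
have [K hK] := penalty_eventually_constant.
have [alow0 blow0 ca0 cb0] := hpos.
pose Ca := calpha^-1 * ((Lfx c + Lg2 c) * Cerr) ^+ 2.
pose Cb := cbeta^-1 * (gam^-1 * Cerr) ^+ 2.
pose Cc := gam * M ^+ 2.
have Ca0 : 0 <= Ca by rewrite mulr_ge0 ?sqr_ge0// invr_ge0 ltW.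
have Cb0 : 0 <= Cb by rewrite mulr_ge0 ?sqr_ge0// invr_ge0 ltW.
have Cc0 : 0 <= Cc by rewrite mulr_ge0 ?sqr_ge0// ltW.
exists K, (Ca + Cb + Cc), (Num.min calpha cbeta / 4); split.
  by rewrite !addr_ge0.
split; first by rewrite divr_gt0// lt_min ca0.
case=> [//|j]; rewrite ltnS => Kj; set k := j.+1.
have [_ outj] := hK j Kj.
have [epk outk] := hK k (leqW Kj).
have [[Xx _ Yyt _] pk0] := iterates_in k.
have [[Xx1 Yy1 Yyt1 Yth1] _] := iterates_in k.+1.
have [ey [Ythh _] ex _ _] := hq.2 k.
have [al0 be0] := ha.2.1 k.
have /andP[_ alk] := halpha k.
have /andP[_ bek] := hbeta k.
have [_ hy] := y_step_descent hP Y0 gam0 (s_tht q k) Xx Yyt pk0 be0 cb0 bek.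
rewrite -ey in hy.
have [_ hx] := x_step_descent hP Y0 gam0 rho_gam Xx Yy1 Ythh pk0 al0 ca0 alk.
rewrite -ex in hx.
have t0 := tol_ge0 k; have t10 := tol_ge0 k.+1.
have [[_ _ Lf0 _] [_ Lg20]] := constants_ge0 hP.
have ey2 : cbeta^-1 * (gam^-1 * enorm (s_tht q k - thetas (s_x q k) (s_yt q k)))
    ^+ 2 <= Cb * tol k ^+ 2.
  rewrite /Cb -mulrA -exprMn -mulrA; apply: ler_wpM2l.
    by rewrite invr_ge0 ltW.
  rewrite ler_pXn2r ?nnegrE//; last 2 first.
  - by rewrite mulr_ge0 ?enorm_ge0// invr_ge0 ltW.
  - by rewrite !mulr_ge0 ?Cerr_ge0// invr_ge0 ltW.
  by apply: ler_wpM2l; [rewrite invr_ge0 ltW|exact: tht_error].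
have ex2 : calpha^-1 * ((Lfx c + Lg2 c) *
    enorm (s_thh q k - thetas (s_x q k) (s_y q k.+1))) ^+ 2 <= Ca * tol k ^+ 2.
  rewrite /Ca -mulrA -exprMn -mulrA; apply: ler_wpM2l.
    by rewrite invr_ge0 ltW.
  rewrite ler_pXn2r ?nnegrE//; last 2 first.
  - by rewrite mulr_ge0 ?enorm_ge0// addr_ge0.
  - by rewrite !mulr_ge0 ?Cerr_ge0// addr_ge0.
  by apply: ler_wpM2l; [rewrite addr_ge0|exact: thh_error].
have hc : merit P a (s_p q k) (s_x q k.+1) (s_yt q k.+1) <=
    merit P a (s_p q k) (s_x q k.+1) (s_y q k.+1) + Cc * tol k.+1 ^+ 2.
  case: outk => [[_ [_ -> _]]|[thh [_ _ [Yh hh] et [hle _]]]].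
    by rewrite lerDl mulr_ge0 ?sqr_ge0.
  rewrite et in hle.
  apply: le_trans
    (correction_descent hP Y0 gam0 Xx1 Yy1 Yth1 Yyt1 Yh eta0 hle) _.
  rewrite lerD2l; apply: ler_wpM2l => //.
  by rewrite ler_pXn2r ?nnegrE ?enorm_ge0.
rewrite -epk Delta_sqr.
have m1 : Num.min calpha cbeta <= calpha by rewrite ge_min lexx.
have m2 : Num.min calpha cbeta <= cbeta by rewrite ge_min lexx orbT.
have dx0 := sqr_ge0 (enorm (s_x q k.+1 - s_x q k)).
have dy0 := sqr_ge0 (enorm (s_y q k.+1 - s_yt q k)).
have m1' := ler_wpM2r dx0 m1; have m2' := ler_wpM2r dy0 m2.
have q0 := sqr_ge0 (tol k); have q1 := sqr_ge0 (tol k.+1).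
move: hx hy ex2 ey2 hc; rewrite -/gam.
exact: (descent_combination Ca0 Cb0 Cc0 q0 q1 m1' m2').
Qed.

Lemma tol_cvg0 : tol k @[k --> \oo] --> (0 : R).
Proof.
have h : tol k ^+ 2 @[k --> \oo] --> (0 : R).
  by apply: bounded_sums_cvg0 tol_sqr_sums => k; exact: sqr_ge0.
have := @cvg_comp _ _ _ _ (@Num.sqrt R) _ _ _ h (@sqrt_continuous R 0).
rewrite sqrtr0; apply: cvg_trans; apply: near_eq_cvg; near=> k => /=.
by rewrite sqrtr_sqr ger0_norm// tol_ge0.
Unshelve. all: by end_near. Qed.

Lemma Delta_cvg0 : Delta q k @[k --> \oo] --> (0 : R).
Proof.
have [K [Ce [kap [Ce0 [kap0 hd]]]]] := merit_descent.
have [Fl hF] := F_bounded_below hP.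
have D2 : bounded_sums (fun k => kap * Delta q k ^+ 2).
  apply: (@bounded_sums_shift _ _ K.+1).
  apply: (@bounded_sums_descent _ (fun k => merit P a (s_p q K)
     (s_x q (k + K.+1)) (s_yt q (k + K.+1))) _
     (fun k => Ce * tol (k + K.+1) ^+ 2 + Ce * tol (k.+1 + K.+1) ^+ 2)
     ((s_p q K)^-1 * Fl)).
  - move=> k; have [[Xx _ Yy _] _] := iterates_in (k + K.+1).
    have [_ p0] := iterates_in K.
    have := vgamma_le_phi hP Y0 gam0 Xx Yy; rewrite -/gam => hv.
    have : (s_p q K)^-1 * Fl <=
        (s_p q K)^-1 * bF P (s_x q (k + K.+1), s_yt q (k + K.+1)).
      apply: ler_wpM2l; first by rewrite invr_ge0 ltW.
      by apply: hF; exists (s_x q (k + K.+1), s_yt q (k + K.+1)).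
    by rewrite /merit -/gam; lra.
  - by move=> k; rewrite addSn; apply: hd; rewrite addnS ltnS leq_addl.
  - apply: bounded_sums_lin => //.
      apply: (@bounded_sums_drop _ (fun k => tol k ^+ 2)) tol_sqr_sums => k.
      exact: sqr_ge0.
    have := @bounded_sums_drop _ (fun k => tol k ^+ 2) K.+2
      (fun k => sqr_ge0 _) tol_sqr_sums.
    by apply: bounded_sums_le => k; rewrite addSnnS.
have D0 : kap * Delta q k ^+ 2 @[k --> \oo] --> (0 : R).
  by apply: bounded_sums_cvg0 D2 => k; rewrite mulr_ge0 ?sqr_ge0// ltW.
have h : kap^-1 * (kap * Delta q k ^+ 2) @[k --> \oo] --> kap^-1 * 0.
  by apply: cvgM D0; exact: cvg_cst.
rewrite mulr0 in h.
have := @cvg_comp _ _ _ _ (@Num.sqrt R) _ _ _ h (@sqrt_continuous R 0).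
rewrite sqrtr0; apply: cvg_trans; apply: near_eq_cvg; near=> k => /=.
rewrite mulrA mulVf ?gt_eqF// mul1r sqrtr_sqr ger0_norm//.
exact: pnorm_ge0.
Unshelve. all: by end_near. Qed.

End Algorithm.

(** * Sequences and subgradients *)

Section Sequences.
Context {R : realType}.

(** A cluster point is a limit along indices tending to infinity. *)
Lemma cluster_subseq {V : pseudoMetricType R} (u : nat -> V) (z : V) :
  cluster (u @ \oo) z ->
  exists s : nat -> nat, (forall j, (j <= s j)%N) /\ u (s j) @[j --> \oo] --> z.
Proof.
move=> hz.
have /choice[s hs] : forall j, exists k, (j <= k)%N /\ ball z j.+1%:R^-1 (u k).
  move=> j; have [] := hz [set u k | k in [set k | (j <= k)%N]]
    (ball z j.+1%:R^-1).
  - by exists j => // k /= jk; exists k.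
  - by apply: nbhsx_ballx; rewrite invr_gt0.
  - by move=> _ [[k jk <-] hk]; exists k.
exists s; split; first by move=> j; have [] := hs j.
apply/cvg_ballP => e e0; near=> j.
apply: le_ball (hs j).2; near: j.
have [N _ hN] := near_infty_natSinv_lt (PosNum e0).
by exists N => // j Nj; apply/ltW/hN.
Unshelve. all: by end_near. Qed.

Lemma cvg_reindex {T : Type} (F : set_system T) (u : nat -> T) (s : nat -> nat) :
  (forall j, (j <= s j)%N) -> u @ \oo --> F -> u (s j) @[j --> \oo] --> F.
Proof.
move=> sj uF A /uF [N _ hN]; exists N => // j Nj; apply: hN.
exact: leq_trans Nj (sj j).
Qed.

Lemma cvg_enorm_bound {n : nat} (u : nat -> 'rV[R]_n) (l : 'rV[R]_n)
    (e : nat -> R) :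
  (forall j, enorm (u j - l) <= e j) -> e j @[j --> \oo] --> (0 : R) ->
  u j @[j --> \oo] --> l.
Proof.
move=> ue e0; apply: cvg_enorm_subP; apply: squeeze_cvgr (cvg_cst 0) e0.
by near=> j; rewrite enorm_ge0 ue.
Unshelve. all: by end_near. Qed.

Lemma cvg_enorm_sub0 {n : nat} (u w : nat -> 'rV[R]_n) (l : 'rV[R]_n) :
  u j @[j --> \oo] --> l -> w j @[j --> \oo] --> l ->
  enorm (u j - w j) @[j --> \oo] --> (0 : R).
Proof.
move=> ul wl; rewrite -(@enorm0 R n) -(subrr l).
by apply: cvg_enorm; exact: cvgB.
Qed.

Lemma within_cvg_seq {T U : topologicalType} (D : set T) (h : T -> U)
    (z : nat -> T) (l : T) :
  {within D, continuous h} -> D l -> (forall j, D (z j)) ->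
  z j @[j --> \oo] --> l -> h (z j) @[j --> \oo] --> h l.
Proof.
move=> hc Dl Dz zl A /((@subspace_continuousP _ _ _ _).1 hc l Dl) hA.
have : \forall j \near \oo, D (z j) -> A (h (z j)) by exact: zl hA.
by apply: filterS => j; apply.
Qed.

Lemma lipschitz_cvg_seq {n m k : nat} (D : set ('rV[R]_n * 'rV[R]_m)) (L : R)
    (G : 'rV[R]_n * 'rV[R]_m -> 'rV[R]_k) z l :
  lipschitz_onE D L G -> D l -> (forall j, D (z j)) ->
  z j @[j --> \oo] --> l -> G (z j) @[j --> \oo] --> G l.
Proof.
move=> LG Dl Dz zl.
apply: (@cvg_enorm_bound _ _ _ (fun j => L * pnorm (z j - l))).
  by move=> j; exact: LG.
rewrite -[X in _ --> X](mulr0 L); apply: cvgM; first exact: cvg_cst.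
have -> : (0 : R) = pnorm (l - l).
  by rewrite subrr (@pnorm_pair0 R n m 0) enorm0.
by apply: cvg_pnorm; apply: cvgB => //; exact: cvg_cst.
Qed.

End Sequences.

Section Subgradient.
Context {R : realType} {n m : nat}.
Variables (P : bilevel R n m) (c : constants R).
Hypothesis hP : standing P c.
Let X := bX P.
Let Y := bY P.
Let g := bg P.

Lemma gradx_phi_lipschitz :
  lipschitz_onE (bXY P) ((Lfx c + Lg1 c) + (Lfx c + Lg2 c)) (gradx (bphi P)).
Proof.
move=> [x' y'] [x y] [/= Xx' Yy'] [/= Xx Yy].
apply: le_trans (enormB_le _ (gradx (bphi P) (x, y')) _) _.
have [[_ _ Lf0 _] [Lg10 Lg20]] := constants_ge0 hP.
rewrite mulrDl; apply: lerD.
  apply: le_trans (gradx_phi_lip_x hP Xx Xx' Yy') _.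
  by apply: ler_wpM2l; [exact: addr_ge0|exact: (enorm1_le_pnorm (_, _))].
apply: le_trans (gradx_phi_lip_y hP Xx Yy Yy') _.
by apply: ler_wpM2l; [exact: addr_ge0|exact: (enorm2_le_pnorm (_, _))].
Qed.

(** A partial subgradient of [g] in [y], completed by the partial gradient in
    [x], is a Frechet subgradient of [g] on [X * Y]: the partial gradient in
    [x] is Lipschitz in both variables, so that the error is quadratic. *)
Lemma partial_subgradient x y zeta : X x -> Y y ->
  (forall w, Y w -> g (x, y) + dot zeta (w - y) <= g (x, w)) ->
  subdiff_g P (x, y) (gradx g (x, y), zeta).
Proof.
move=> Xx Yy hz.
set h := fun w => ((bg P w)%:E + indicator_fun R (bXY P) w)%E.
have hin z : bXY P z -> h z = (g z)%:E.
  by move=> Dz; rewrite /h /indicator_fun mem_set// adde0.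
have hout z : ~ bXY P z -> h z = +oo%E.
  by move=> Dz; rewrite /h /indicator_fun memNset.
have Dxy : bXY P (x, y) by [].
have hfin : h (x, y) \is a fin_num by rewrite hin.
suff hf : frechet_subdiff h (x, y) (gradx g (x, y), zeta).
  split => //; exists (fun=> (x, y)), (fun=> (gradx g (x, y), zeta)).
  by split => //; exact: cvg_cst.
split => // e e0.
have [[_ _ _ _] [Lg10 Lg20]] := constants_ge0 hP.
pose C := Lg1 c / 2 + Lg2 c + 1.
have C0 : 0 < C by rewrite ltr_wpDl// addr_ge0// divr_ge0.
have : \forall z' \near (x, y), pnorm (z' - (x, y)) < e / C.
  have : pnorm (z' - (x, y)) @[z' --> (x, y)] --> pnorm ((x, y) - (x, y)).
    by apply: cvg_pnorm; apply: cvgB; [exact: cvg_id|exact: cvg_cst].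
  rewrite subrr (@pnorm_pair0 R n m 0) enorm0 => /cvgr_lt; apply.
  exact: divr_gt0.
apply: filterS => -[x' y'] small.
have [[/= Xx' Yy']|nD] := pselect (bXY P (x', y')); last first.
  by rewrite (hout _ nD) leey.
rewrite !hin// -EFinD lee_fin /pdot /=.
have h1 := hz _ Yy'.
have := @descent _ _ X (X_convex hP) (fun u => g (u, y')) (Lg1 c) x x'
  (fun w Xw => g_differentiable_x hP Xw Yy')
  (fun w Xw => gradxg_lipschitz_x hP Yy' Xw Xx) Xx Xx'.
rewrite ler_norml => /andP[h2 _].
have h3 := gradxg_lipschitz_y hP Xx Yy' Yy.
have h4 := dot_ge (gradx g (x, y') - gradx g (x, y)) (x' - x).
have dE : dot (gradx g (x, y') - gradx g (x, y)) (x' - x) =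
  dot (gradx g (x, y')) (x' - x) - dot (gradx g (x, y)) (x' - x).
  by rewrite dotDl dotNl.
rewrite {}dE in h4.
set r := pnorm ((x', y') - (x, y)) in small *.
have r0 : 0 <= r by exact: pnorm_ge0.
have rx : enorm (x' - x) <= r by exact: (enorm1_le_pnorm ((x', y') - (x, y))).
have ry : enorm (y' - y) <= r by exact: (enorm2_le_pnorm ((x', y') - (x, y))).
have ex0 := enorm_ge0 (x' - x); have ey0 := enorm_ge0 (y' - y).
have h5 : enorm (gradx g (x, y') - gradx g (x, y)) * enorm (x' - x) <=
    Lg2 c * r ^+ 2.
  rewrite expr2 mulrA; apply: ler_pM => //; first exact: enorm_ge0.
  by apply: le_trans h3 _; apply: ler_wpM2l.
have h6 : Lg1 c / 2 * enorm (x' - x) ^+ 2 <= Lg1 c / 2 * r ^+ 2.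
  by apply: ler_wpM2l; rewrite ?divr_ge0// ler_pXn2r ?nnegrE.
have h7 : C * r ^+ 2 <= e * r.
  rewrite expr2 mulrA; apply: ler_wpM2r => //.
  by rewrite mulrC -ler_pdivlMr// ltW.
have r20 : 0 <= r ^+ 2 by exact: sqr_ge0.
change (dot (grad (fun u => g (u, y')) x) (x' - x)) with
  (dot (gradx g (x, y')) (x' - x)) in h2.
move: h1 h2 h4 h5 h6 h7; rewrite /C.
change (bg P) with g.
move: (g _) (g _) (g _) (dot _ _) (dot _ _) (dot _ _) => g1 g2 g3 d1 d2 d3.
move: (r ^+ 2) r20 => r2 *; lra.
Qed.

End Subgradient.

(** * Passage to the limit *)

Section Limit.
Context {R : realType} {n m : nat}.
Variables (P : bilevel R n m) (c : constants R) (a : agils_param R)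
  (q : agils_seq R n m) (alow blow calpha cbeta : R).
Hypothesis hP : standing P c.
Hypothesis ha : agils_param_ok a.
Hypothesis hgam : rhof2 c + rhog2 c = 0 \/ a_gam a < 1 / (rhof2 c + rhog2 c).
Hypothesis hpos : [/\ 0 < alow, 0 < blow, 0 < calpha & 0 < cbeta].
Hypothesis halpha : forall k,
  alow <= a_alpha a k <= 2 / (Lpsix c (s_p q k) + calpha).
Hypothesis hbeta : forall k,
  blow <= a_beta a k <= 2 / (Lpsiy c (s_p q k) + cbeta).
Hypothesis hq : agils P a q.
Hypothesis hp : exists M : R, forall k, `|s_p q k| <= M.

Let X := bX P.
Let Y := bY P.
Let f := bf P.
Let g := bg P.
Let phi := bphi P.
Let gam := a_gam a.
Local Notation thetas x y := (thetastar P gam (x, y)).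
Let Y0 := Y_neq0 hq.
Let gam0 := gam_gt0 ha.
Let eta0 := eta_gt0 ha.

(** Approximate feasibility.  After a sufficient move the bound on the gap
    comes from the residual [tres]; after a correction, from the approximate
    minimality of the corrected point for [phi (x, _)]. *)
Lemma gap_bound k : moved P a q k \/ corrected P a q k ->
  exists w, [/\ Y w,
    enorm (s_yt q k.+1 - w) <= a_cyt a / s_p q k * Delta q k &
    Delta q k < a_cp a / s_p q k ->
    gap P a (s_x q k.+1) (s_yt q k.+1) (s_tht q k.+1) <=
      a_eps a + Delta q k / a_cp a
      + (g (s_x q k.+1, s_yt q k.+1) - g (s_x q k.+1, w))
      + enorm (s_yt q k.+1 - w) *
        (enorm (s_tht q k.+1 - w) +
         enorm (grady f (s_x q k.+1, s_yt q k.+1)))].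
Proof.
have [[eps0 _ _] [_ [[_ _ cp0 _ cyt0] _]]] := ha.
have [_ pk0] := iterates_in hP ha hq k.
have [[Xx Yy Yyt Yth] _] := iterates_in hP ha hq k.+1.
have D0 : 0 <= Delta q k by exact: pnorm_ge0.
have cD0 : 0 <= a_cyt a / s_p q k * Delta q k.
  by rewrite mulr_ge0// divr_ge0// ltW.
case=> [[mv [_ -> ->]]|[thh [_ hw [Ythh _] et _]]].
  (* After a move the point is left unchanged. *)
  exists (s_y q k.+1); split => //; first by rewrite subrr enorm0.
  move=> small; rewrite !subrr enorm0 mul0r !addr0.
  have : tres P a q k <= Delta q k / a_cp a.
    rewrite ler_pdivlMr// mulrC.
    move: mv; rewrite minEle; case: ifPn => // _ hle.
    by move: small; rewrite ltNge hle.
  by rewrite /tres ge_max => /andP[h _]; lra.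
have YT : Y (s_tht q k.+1).
  rewrite et.
  by have [] := prox_step_bound hP Y0 gam0 eta0 (s_yt q k.+1) Xx Ythh.
have [Yw hpr] := Prox_indicator
  (s_yt q k.+1 - grady f (s_x q k.+1, s_yt q k.+1))
  (Y_closed hP) (Y_convex hP) Y0 (g_convex_on hP Xx)
  (within_section Xx (g_continuous hP)).
set w := Prox _ _ in Yw hpr.
exists w; split => // _.
have h1 := hpr _ YT.
have h2 := f_first_order hP Xx Yyt YT.
move: h1 h2; rewrite /gap.
set x1 := s_x q k.+1; set y := s_yt q k.+1; set th := s_tht q k.+1.
have -> : bphi P (x1, y) = f (x1, y) + g (x1, y) by [].
have -> : bphi P (x1, th) = f (x1, th) + g (x1, th) by [].
change (bg P) with g; change (bf P) with f.
set D := grady f (x1, y).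
clearbody w y th D x1 => h1 h2.
have E : dot (y - D - w) (th - w) + dot D (th - y) =
    dot (y - w) (th - w) - dot D (y - w).
  by rewrite !dotE; ring.
have b1 := dot_ge (y - w) (th - w); have b2 := dot_le D (y - w).
have q1 : 0 <= (2 * a_gam a)^-1 * enorm (th - y) ^+ 2.
  by rewrite mulr_ge0 ?sqr_ge0// invr_ge0 mulr_ge0// ltW.
have q2 : 0 <= Delta q k / a_cp a by rewrite divr_ge0// ltW.
lra.
Qed.

Section Subsequence.
Variables (p : R) (nu : nat -> nat) (xbar : 'rV[R]_n) (ybar : 'rV[R]_m).
Hypothesis p0 : 0 < p.
Hypothesis nu_ge : forall j, (j <= nu j)%N.
Hypothesis hnu : forall j, s_p q (nu j) = p /\ s_p q (nu j).+1 = p /\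
  (moved P a q (nu j) \/ corrected P a q (nu j)).
Hypothesis x_cvg : s_x q (nu j).+2 @[j --> \oo] --> xbar.
Hypothesis y_cvg : s_y q (nu j).+2 @[j --> \oo] --> ybar.

(* Iteration nu j settles the penalty parameter and produces the point
   (xa, ya) with its lower-level approximation ta; the next iteration moves
   from there to (xb, yb), which converges to (xbar, ybar). *)
Let xa j := s_x q (nu j).+1.
Let ya j := s_yt q (nu j).+1.
Let ta j := s_tht q (nu j).+1.
Let xb j := s_x q (nu j).+2.
Let yb j := s_y q (nu j).+2.
Let hh j := s_thh q (nu j).+1.
Let zbar := (xbar, ybar).
Let tbar := thetas xbar ybar.

Let nu1_ge j : (j <= (nu j).+1)%N. Proof. exact: leqW. Qed.

Let Dcvg : Delta q (nu j).+1 @[j --> \oo] --> (0 : R).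
Proof.
apply: (@cvg_reindex _ _ (Delta q) (fun j => (nu j).+1) nu1_ge).
exact: Delta_cvg0 hP ha hgam hpos halpha hbeta hq hp.
Qed.

Let Dcvg' : Delta q (nu j) @[j --> \oo] --> (0 : R).
Proof.
apply: (@cvg_reindex _ _ (Delta q) nu nu_ge).
exact: Delta_cvg0 hP ha hgam hpos halpha hbeta hq hp.
Qed.

Let tolcvg : Cerr c a * tol P a q (nu j).+1 @[j --> \oo] --> (0 : R).
Proof.
rewrite -[X in _ --> X](mulr0 (Cerr c a)); apply: cvgM; first exact: cvg_cst.
apply: (@cvg_reindex _ _ (tol P a q) (fun j => (nu j).+1) nu1_ge).
exact: tol_cvg0 ha hq.
Qed.

Let cvg_of_sub {k : nat} (u w : nat -> 'rV[R]_k) (l : 'rV[R]_k) (e : nat -> R) :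
  w j @[j --> \oo] --> l -> (forall j, enorm (u j - w j) <= e j) ->
  e j @[j --> \oo] --> (0 : R) -> u j @[j --> \oo] --> l.
Proof.
move=> wl uw e0.
apply: (@cvg_enorm_bound _ _ _ _ (fun j => e j + enorm (w j - l))).
  by move=> j; apply: le_trans (enormB_le _ (w j) _) _; rewrite lerD2r.
rewrite -[X in _ --> X](addr0 0); apply: cvgD => //.
rewrite -(@enorm0 R k) -(subrr l); apply: cvg_enorm; apply: cvgB => //.
exact: cvg_cst.
Qed.

Let xa_cvg : xa j @[j --> \oo] --> xbar.
Proof.
apply: (@cvg_of_sub _ _ xb _ (fun j => Delta q (nu j).+1)) => // j.
by rewrite enorm_distC; exact: (enorm1_le_pnorm ((xb j, yb j) - (xa j, ya j))).
Qed.

Let ya_cvg : ya j @[j --> \oo] --> ybar.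
Proof.
apply: (@cvg_of_sub _ _ yb _ (fun j => Delta q (nu j).+1)) => // j.
by rewrite enorm_distC; exact: (enorm2_le_pnorm ((xb j, yb j) - (xa j, ya j))).
Qed.

Let Xxa j : X (xa j).
Proof. by have [[]] := iterates_in hP ha hq (nu j).+1. Qed.

Let Yya j : Y (ya j).
Proof. by have [[]] := iterates_in hP ha hq (nu j).+1. Qed.

Let Xxb j : X (xb j).
Proof. by have [[]] := iterates_in hP ha hq (nu j).+2. Qed.

Let Yyb j : Y (yb j).
Proof. by have [[]] := iterates_in hP ha hq (nu j).+2. Qed.

Let Yhh j : Y (hh j).
Proof. by have [_ [? _] _ _ _] := hq.2 (nu j).+1. Qed.

Let Xbar : X xbar.
Proof.
by apply: (@closed_cvg _ _ _ _ xb X (X_closed hP) _ _ x_cvg); exact: nearW.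
Qed.

Let Ybar : Y ybar.
Proof.
by apply: (@closed_cvg _ _ _ _ yb Y (Y_closed hP) _ _ y_cvg); exact: nearW.
Qed.

Let Ytbar : Y tbar. Proof. exact (thetastar_in hP Y0 gam0 ybar Xbar). Qed.

Let thetas_cvg (u : nat -> 'rV[R]_n) (w : nat -> 'rV[R]_m) :
  (forall j, X (u j)) -> u j @[j --> \oo] --> xbar ->
  w j @[j --> \oo] --> ybar -> thetas (u j) (w j) @[j --> \oo] --> tbar.
Proof.
move=> Xu ux wy.
apply: (@cvg_enorm_bound _ _ _ _ (fun j => enorm (w j - ybar) +
  gam * (Lfx c + Lg2 c) * enorm (u j - xbar))).
  by move=> j; exact (thetastar_lipschitz hP Y0 gam0 ybar (w j) Xbar (Xu j)).
rewrite -[X in _ --> X](addr0 0); apply: cvgD.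
  by apply: cvg_enorm_sub0 wy _; exact: cvg_cst.
rewrite -[X in _ --> X](mulr0 (gam * (Lfx c + Lg2 c))); apply: cvgM.
  exact: cvg_cst.
by apply: cvg_enorm_sub0 ux _; exact: cvg_cst.
Qed.

Let ta_cvg : ta j @[j --> \oo] --> tbar.
Proof.
apply: cvg_of_sub (thetas_cvg Xxa xa_cvg ya_cvg) _ tolcvg => j.
by have [_ [_ hj]] := hnu j; exact: tht_error hP ha hq _ hj.
Qed.

Let hh_cvg : hh j @[j --> \oo] --> tbar.
Proof.
apply: cvg_of_sub (thetas_cvg Xxa xa_cvg y_cvg) _ tolcvg => j.
exact: thh_error hP ha hq _.
Qed.

Let pair_cvg (u : nat -> 'rV[R]_n) (w : nat -> 'rV[R]_m)
    (u0 : 'rV[R]_n) (w0 : 'rV[R]_m) :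
  u j @[j --> \oo] --> u0 -> w j @[j --> \oo] --> w0 ->
  (u j, w j) @[j --> \oo] --> (u0, w0).
Proof. exact: (@cvg_pair _ _ _ \oo (nbhs u0) (nbhs w0)). Qed.

Let cvg_G {k : nat} (G : 'rV[R]_n * 'rV[R]_m -> 'rV[R]_k) L
    (u : nat -> 'rV[R]_n) (w : nat -> 'rV[R]_m)
    (u0 : 'rV[R]_n) (w0 : 'rV[R]_m) :
  lipschitz_onE (bXY P) L G -> (forall j, X (u j)) -> (forall j, Y (w j)) ->
  X u0 -> Y w0 ->
  u j @[j --> \oo] --> u0 -> w j @[j --> \oo] --> w0 ->
  G (u j, w j) @[j --> \oo] --> G (u0, w0).
Proof.
move=> LG Xu Yw Xu0 Yw0 uu ww.
apply: (@lipschitz_cvg_seq _ _ _ _ (bXY P) L G (fun j => (u j, w j))).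
- exact: LG.
- by split.
- by move=> j; split; [exact: Xu|exact: Yw].
- exact: pair_cvg.
Qed.

Let cvg_h (h : 'rV[R]_n * 'rV[R]_m -> R)
    (u : nat -> 'rV[R]_n) (w : nat -> 'rV[R]_m)
    (u0 : 'rV[R]_n) (w0 : 'rV[R]_m) :
  {within bXY P, continuous h} -> (forall j, X (u j)) -> (forall j, Y (w j)) ->
  X u0 -> Y w0 ->
  u j @[j --> \oo] --> u0 -> w j @[j --> \oo] --> w0 ->
  h (u j, w j) @[j --> \oo] --> h (u0, w0).
Proof.
move=> hc Xu Yw Xu0 Yw0 uu ww.
apply: (@within_cvg_seq _ _ (bXY P) h (fun j => (u j, w j))).
- exact: hc.
- by split.
- by move=> j; split; [exact: Xu|exact: Yw].
- exact: pair_cvg.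
Qed.

(** Limit of the directions [dy]. *)
Definition dybar : 'rV[R]_m :=
  p^-1 *: grady (bF P) zbar + grady f zbar - gam^-1 *: (ybar - tbar).

(** Limit of the directions [dx]; the sum of the partial gradients of [f] and
    [g] at the lower-level solution is written as the one of [phi]. *)
Definition dxbar : 'rV[R]_n :=
  p^-1 *: gradx (bF P) zbar + gradx phi zbar - gradx phi (xbar, tbar).

Let dy_cvg : dy P a q (nu j).+1 @[j --> \oo] --> dybar.
Proof.
have -> : (fun j => dy P a q (nu j).+1) = (fun j =>
    p^-1 *: grady (bF P) (xa j, ya j) + grady f (xa j, ya j)
    - gam^-1 *: (ya j - ta j)).
  by apply/funext => j; rewrite /dy (hnu j).2.1.
apply: cvgB.
  apply: cvgD; last first.
    exact: cvg_G (gradyf_lipschitz hP) Xxa Yya Xbar Ybar xa_cvg ya_cvg.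
  apply: cvgZ; first exact: cvg_cst.
  exact: cvg_G (gradyF_lipschitz hP) Xxa Yya Xbar Ybar xa_cvg ya_cvg.
apply: cvgZ; first exact: cvg_cst.
exact: cvgB.
Qed.

Let dx_cvg : dx P q (nu j).+1 @[j --> \oo] --> dxbar.
Proof.
have -> : (fun j => dx P q (nu j).+1) = (fun j =>
    p^-1 *: gradx (bF P) (xa j, yb j) + gradx phi (xa j, yb j)
    - gradx phi (xa j, hh j)).
  apply/funext => j; rewrite /dx (hnu j).2.1 -addrA -opprD.
  by rewrite -(gradx_phi hP (Xxa j) (Yhh j)).
apply: cvgB; last first.
  exact: cvg_G (gradx_phi_lipschitz hP) Xxa Yhh Xbar Ytbar xa_cvg hh_cvg.
apply: cvgD; last first.
  exact: cvg_G (gradx_phi_lipschitz hP) Xxa Yyb Xbar Ybar xa_cvg y_cvg.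
apply: cvgZ; first exact: cvg_cst.
exact: cvg_G (gradxF_lipschitz hP) Xxa Yyb Xbar Ybar xa_cvg y_cvg.
Qed.

Let cvg_cstB {k : nat} (u : nat -> 'rV[R]_k) (l w : 'rV[R]_k) :
  u j @[j --> \oo] --> l -> w - u j @[j --> \oo] --> w - l.
Proof. by move=> ul; apply: cvgB => //; exact: cvg_cst. Qed.

(** In the limit of the [y]-steps, [- dybar] is a subgradient of [g (xbar, _)]
    on [Y]; the step sizes enter only through their positive lower bound. *)
Lemma y_stationary w : Y w ->
  g zbar + dot (- dybar) (w - ybar) <= g (xbar, w).
Proof.
move=> Yw; have [alow0 blow0 _ _] := hpos.
have lim1 : g (xa j, yb j) - blow^-1 * (enorm (ya j - yb j) * enorm (w - yb j))
    + dot (- dy P a q (nu j).+1) (w - yb j) @[j --> \oo] -->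
    g zbar - blow^-1 * (0 * enorm (w - ybar)) + dot (- dybar) (w - ybar).
  apply: cvgD; last first.
    by apply: cvg_dot; [exact: cvgN|exact: cvg_cstB].
  apply: cvgB.
    exact: cvg_h (g_continuous hP) Xxa Yyb Xbar Ybar xa_cvg y_cvg.
  apply: cvgM; first exact: cvg_cst.
  apply: cvgM; first exact: cvg_enorm_sub0 ya_cvg y_cvg.
  by apply: cvg_enorm; exact: cvg_cstB.
have lim2 : g (xa j, w) @[j --> \oo] --> g (xbar, w).
  apply: cvg_h (g_continuous hP) Xxa (fun=> Yw) Xbar Yw xa_cvg _.
  exact: cvg_cst.
rewrite mul0r mulr0 subr0 in lim1.
apply: ler_cvg_to lim1 lim2 _; apply: nearW => j.
have [ey _ _ _ _] := hq.2 (nu j).+1.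
have [_ b0] := ha.2.1 (nu j).+1.
have /andP[bb _] := hbeta (nu j).+1.
have [_ hpr] := Prox_g hP Y0 (ya j - a_beta a (nu j).+1 *: dy P a q (nu j).+1)
  (Xxa j) b0.
rewrite -ey in hpr; have {hpr} := hpr _ Yw.
change (bg P) with g; rewrite -/(yb j) -/(xa j).
set b := a_beta a (nu j).+1 in b0 bb *.
rewrite (_ : ya j - _ - yb j =
  (ya j - yb j) - b *: dy P a q (nu j).+1); last first.
  by rewrite addrAC.
move=> hpr; rewrite dotDl dotNl dotZl mulrDr mulrN mulrA in hpr.
rewrite mulVf ?gt_eqF// mul1r in hpr; rewrite dotNl.
have h1 := dot_ge (ya j - yb j) (w - yb j).
have bi : b^-1 <= blow^-1 by rewrite lef_pV2.
have e0 : 0 <= enorm (ya j - yb j) * enorm (w - yb j).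
  by rewrite mulr_ge0 ?enorm_ge0.
have h2 := ler_wpM2r e0 bi.
have bi0 : 0 < b^-1 by rewrite invr_gt0.
have h3 := ler_wpM2l (ltW bi0) h1.
by move: hpr h2 h3; lra.
Qed.

(** In the limit of the [x]-steps, [- dxbar] is normal to [X] at [xbar]. *)
Lemma x_stationary w : X w -> 0 <= dot dxbar (w - xbar).
Proof.
move=> Xw; have [alow0 blow0 _ _] := hpos.
have lim1 : dot (dx P q (nu j).+1) (w - xb j)
   + alow^-1 * (enorm (xa j - xb j) * enorm (w - xb j)) @[j --> \oo] -->
   dot dxbar (w - xbar) + alow^-1 * (0 * enorm (w - xbar)).
  apply: cvgD; first by apply: cvg_dot => //; exact: cvg_cstB.
  apply: cvgM; first exact: cvg_cst.
  apply: cvgM; first exact: cvg_enorm_sub0 xa_cvg x_cvg.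
  by apply: cvg_enorm; exact: cvg_cstB.
rewrite mul0r mulr0 addr0 in lim1.
apply: ler_cvg_to (cvg_cst 0) lim1 _; apply: nearW => j.
have [_ _ ex _ _] := hq.2 (nu j).+1.
have [al0 _] := ha.2.1 (nu j).+1.
have /andP[bb _] := halpha (nu j).+1.
have [_ hpr] := Proj_variational
  (xa j - a_alpha a (nu j).+1 *: dx P q (nu j).+1) (X_closed hP) (X_convex hP)
  (ex_intro _ _ Xbar).
rewrite -ex in hpr; have {hpr} := hpr _ Xw.
rewrite -/(xb j); set al := a_alpha a (nu j).+1 in al0 bb *.
rewrite (_ : xa j - _ - xb j =
  (xa j - xb j) - al *: dx P q (nu j).+1); last first.
  by rewrite addrAC.
move=> hpr; rewrite dotDl dotNl dotZl in hpr.
have h1 := dot_ge (xa j - xb j) (w - xb j).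
have bi : al^-1 <= alow^-1 by rewrite lef_pV2.
have e0 : 0 <= enorm (xa j - xb j) * enorm (w - xb j).
  by rewrite mulr_ge0 ?enorm_ge0.
have h2 := ler_wpM2r e0 bi.
have h3 : - (enorm (xa j - xb j) * enorm (w - xb j)) <=
   al * dot (dx P q (nu j).+1) (w - xb j) by lra.
rewrite -ler_pdivrMl// in h3.
by move: h2 h3 => /=; lra.
Qed.

Lemma limit_feasible : phi zbar - vgamma P gam zbar <= a_eps a.
Proof.
have [_ [_ [[_ _ cp0 _ cyt0] _]]] := ha.
have /choice[w hw] : forall j, exists w, [/\ Y w,
    enorm (ya j - w) <= a_cyt a / p * Delta q (nu j) &
    Delta q (nu j) < a_cp a / p ->
    gap P a (xa j) (ya j) (ta j) <= a_eps a + Delta q (nu j) / a_cp a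
      + (g (xa j, ya j) - g (xa j, w))
      + enorm (ya j - w) * (enorm (ta j - w) + enorm (grady f (xa j, ya j)))].
  by move=> j; have [ep [_ /gap_bound]] := hnu j; rewrite ep.
have Yw j : Y (w j) by have [] := hw j.
have w_cvg : w j @[j --> \oo] --> ybar.
  apply: (@cvg_of_sub _ _ ya _ (fun j => a_cyt a / p * Delta q (nu j))) => //.
    by move=> j; rewrite enorm_distC; have [] := hw j.
  rewrite -[X in _ --> X](mulr0 (a_cyt a / p)); apply: cvgM => //.
  exact: cvg_cst.
have phi_c := phi_within hP.
have lim1 : gap P a (xa j) (ya j) (ta j) @[j --> \oo] -->
    phi zbar - phi (xbar, tbar)
    - (2 * gam)^-1 * (enorm (tbar - ybar) * enorm (tbar - ybar)).
  have Yta j : Y (ta j).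
    rewrite /ta.
    have [_ [_ [[_ [_ _ ->]]|[thh [_ _ [Ythh _] et _]]]]] := hnu j.
      by have [[]] := iterates_in hP ha hq (nu j).+1.
    rewrite et.
    by have [] := prox_step_bound hP Y0 gam0 eta0 (ya j) (Xxa j) Ythh.
  apply: cvgB.
    apply: cvgB; first exact: cvg_h phi_c Xxa Yya Xbar Ybar xa_cvg ya_cvg.
    exact: cvg_h phi_c Xxa Yta Xbar Ytbar xa_cvg ta_cvg.
  apply: cvgM; first exact: cvg_cst.
  by apply: cvgM; apply: cvg_enorm; exact: cvgB.
have lim2 : a_eps a + Delta q (nu j) / a_cp a
      + (g (xa j, ya j) - g (xa j, w j))
      + enorm (ya j - w j) * (enorm (ta j - w j) + enorm (grady f (xa j, ya j)))
   @[j --> \oo] --> a_eps a + 0 / a_cp a + (g zbar - g zbar)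
      + 0 * (enorm (tbar - ybar) + enorm (grady f zbar)).
  apply: cvgD.
    apply: cvgD.
      apply: cvgD; first exact: cvg_cst.
      by apply: cvgM => //; exact: cvg_cst.
    apply: cvgB.
      exact: cvg_h (g_continuous hP) Xxa Yya Xbar Ybar xa_cvg ya_cvg.
    exact: cvg_h (g_continuous hP) Xxa Yw Xbar Ybar xa_cvg w_cvg.
  apply: cvgM; first exact: cvg_enorm_sub0 ya_cvg w_cvg.
  apply: cvgD; first by apply: cvg_enorm; exact: cvgB.
  apply: cvg_enorm.
  exact: cvg_G (gradyf_lipschitz hP) Xxa Yya Xbar Ybar xa_cvg ya_cvg.
rewrite !mul0r subrr !addr0 in lim2.
rewrite (vgammaE hP Y0 gam0 _ Xbar) /lower_obj -/tbar expr2 opprD addrA.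
apply: ler_cvg_to lim1 lim2 _.
have cpp : 0 < a_cp a / p by rewrite divr_gt0.
near=> j; have [_ _] := hw j; apply.
by near: j; exact: (cvgr_lt _ Dcvg' _ cpp).
Unshelve. all: by end_near. Qed.

(** The multiplier is the final penalty parameter. *)
Lemma limit_KKT :
  is_KKT P gam (phi zbar - vgamma P gam zbar) zbar.
Proof.
split => //; exists p; split; [exact: ltW| |by rewrite subrr mulr0].
exists (gradx g zbar, - dybar), (- p *: dxbar, 0); split.
- exact (partial_subgradient hP Xbar Ybar y_stationary).
- move=> [u1 u2] [/= Xu _]; rewrite /pdot /= dotZl dot0l.
  by rewrite addr0 mulNr oppr_le0 mulr_ge0 ?x_stationary ?ltW.
have E1 : gradx phi zbar = gradx f zbar + gradx g zbar.
  exact (gradx_phi hP Xbar Ybar).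
have E2 : gradx phi (xbar, tbar) = gradx f (xbar, tbar) + gradx g (xbar, tbar).
  exact (gradx_phi hP Xbar Ytbar).
have pn0 : p != 0 by rewrite gt_eqF.
congr (_, _); rewrite /=.
- rewrite /dxbar E1 E2 -/tbar; apply/rowP => i; rewrite !mxE.
  by rewrite -/f -/g; field.
- rewrite /dybar -/tbar addr0; apply/rowP => i; rewrite !mxE.
  by rewrite -/f -/gam; field; rewrite pn0 gt_eqF.
Qed.

End Subsequence.
End Limit.

Theorem theorem4p10 (R : realType) (n m : nat) (P : bilevel R n m)
    (c : constants R) (a : agils_param R) (q : agils_seq R n m)
    (alow blow calpha cbeta : R)
    (hP : standing P c)
    (ha : agils_param_ok a)
    (hgam : rhof2 c + rhog2 c = 0 \/ a_gam a < 1 / (rhof2 c + rhog2 c))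
    (hpos : [/\ 0 < alow, 0 < blow, 0 < calpha & 0 < cbeta])
    (halpha : forall k,
      alow <= a_alpha a k <= 2 / (Lpsix c (s_p q k) + calpha))
    (hbeta : forall k,
      blow <= a_beta a k <= 2 / (Lpsiy c (s_p q k) + cbeta))
    (hq : agils P a q)
    (hp : exists M : R, forall k, `|s_p q k| <= M)
    (xbar : 'rV[R]_n) (ybar : 'rV[R]_m)
    (hbar : cluster ((s_x q k, s_y q k) @[k --> \oo]) (xbar, ybar)) :
  exists epsbar : R, epsbar <= a_eps a /\ is_KKT P (a_gam a) epsbar (xbar, ybar).
Proof.
have [K hK] := penalty_eventually_constant ha hq hp.
have [s [sj scvg]] := cluster_subseq hbar.
(* The subsequence is shifted so that two iterations with the final penalty
   parameter precede each of its terms. *)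
pose nu j := (s (j + K.+2)%N).-2.
have nuE j : (nu j).+2 = s (j + K.+2)%N.
  have := sj (j + K.+2)%N; rewrite /nu.
  by case: (s _) => [|[|i]] //; rewrite !addnS.
have nuK j : (j + K <= nu j)%N by rewrite -2!ltnS nuE -!addnS.
have nuj j : (j <= nu j)%N by apply: leq_trans (nuK j); exact: leq_addr.
have Knu j : (K <= nu j)%N by apply: leq_trans (nuK j); exact: leq_addl.
have hnu j : s_p q (nu j) = s_p q K /\ s_p q (nu j).+1 = s_p q K /\
    (moved P a q (nu j) \/ corrected P a q (nu j)).
  have [-> out] := hK _ (Knu j).
  by have [-> _] := hK _ (leqW (Knu j)).
have zcvg : (s_x q (nu j).+2, s_y q (nu j).+2) @[j --> \oo] --> (xbar, ybar).
  have -> : (fun j => (s_x q (nu j).+2, s_y q (nu j).+2)) =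
      (fun j => (fun j => (s_x q (s j), s_y q (s j))) (j + K.+2)%N).
    by apply/funext => j; rewrite nuE.
  by apply: cvg_reindex scvg => j; exact: leq_addr.
have xcvg : s_x q (nu j).+2 @[j --> \oo] --> xbar.
  exact: (cvg_comp _ _ zcvg (@cvg_fst _ _ _ _ _)).
have ycvg : s_y q (nu j).+2 @[j --> \oo] --> ybar.
  exact: (cvg_comp _ _ zcvg (@cvg_snd _ _ _ _ _)).
have [_ p0] := iterates_in hP ha hq K.
exists (bphi P (xbar, ybar) - vgamma P (a_gam a) (xbar, ybar)); split.
  exact: (limit_feasible hP ha hgam hpos halpha hbeta hq hp p0 nuj hnu xcvg ycvg).
exact: (limit_KKT hP ha hgam hpos halpha hbeta hq hp p0 nuj hnu xcvg ycvg).
Qed.
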